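(* Assume that there is $\alpha\in\left(0,\frac12\right)$ such that $\rho=\rho(\epsilon)$ is defined in the asymptotic range $\epsilon^{\frac{3}{1+\alpha}}\ll\rho\leq\epsilon^2$, and let ${\bf a}_0\in\ell^2(\mathbb{Z})$ be fixed independently of $\epsilon$. There is $A_0>0$ such that for every $A\in(0,A_0)$, there is a small $\epsilon_0>0$ and positive constants $C_0$ and $C$ (independent of $\epsilon$) such that for every $\epsilon\in(0,\epsilon_0)$ for which the initial data satisfies $$\|\xi(0)-{\bf X}(0)\|_{\ell^2}+\|\dot{\xi}(0)-\dot{\bf X}(0)\|_{\ell^2}\leq C_0\,\rho^{-1}\epsilon^3,$$ the solution $\xi(t)$ of the discrete Klein--Gordon equation $$\ddot{\xi}_j+\xi_j+\rho\,\xi_j^3=\epsilon(\xi_{j+1}+\xi_{j-1}),\qquad j\in\mathbb{Z},$$ satisfies, for every $t\in[-A|\log(\rho)|\rho^{-1},\,A|\log(\rho)|\rho^{-1}]$, $$\|\xi(t)-{\bf X}(t)\|_{\ell^2}+\|\dot{\xi}(t)-\dot{\bf X}(t)\|_{\ell^2}\leq C\,\rho^{-1-\alpha}\epsilon^3.$$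
   Context: Here $\xi(t)=\{\xi_j(t)\}_{j\in\mathbb{Z}}$ is real-valued with $\xi(t),\dot\xi(t)\in\ell^2(\mathbb{Z})$, and dots on $\xi$ and ${\bf X}$ denote $d/dt$. The notation $\epsilon^{3/(1+\alpha)}\ll\rho\le\epsilon^2$ means that $\rho=\rho(\epsilon)>0$ satisfies $\rho\leq\epsilon^2$ and $\epsilon^{3/(1+\alpha)}/\rho\to0$ as $\epsilon\to0^+$. Set $\delta=\rho/\epsilon^2$ and let ${\bf a}(\tau)=\{a_j(\tau)\}_{j\in\mathbb{Z}}$, $a_j(\tau)\in\mathbb{C}$, be the global solution in $\ell^2(\mathbb{Z})$ of the generalized discrete nonlinear Schr\''odinger equation $$2i\dot a_j+3\epsilon\delta|a_j|^2a_j=a_{j+1}+a_{j-1}+\frac{\epsilon}{4}\left(a_{j+2}+2a_j+a_{j-2}\right),\qquad j\in\mathbb{Z},$$ with ${\bf a}(0)={\bf a}_0$, where the dot on $a_j$ is the derivative in the slow time $\tau=\epsilon t$. The leading-order approximation ${\bf X}(t)=\{X_j(t)\}_{j\in\mathbb{Z}}$ is $$X_j(t)=a_j(\epsilon t)e^{it}+\bar a_j(\epsilon t)e^{-it}+\tfrac18\rho\left(a_j^3(\epsilon t)e^{3it}+\bar a_j^3(\epsilon t)e^{-3it}\right).$$ *)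

(* Defs.v *)
From mathcomp Require Export all_boot all_order all_algebra.
From mathcomp Require Export all_classical all_reals all_analysis.
From mathcomp Require Export complex.
Export Order.TTheory GRing.Theory Num.Theory.
Export numFieldNormedType.Exports.

Set Implicit Arguments.
Unset Strict Implicit.
Unset Printing Implicit Defensive.

Local Open Scope classical_set_scope.
Local Open Scope ring_scope.

(* The l^2(Z) norm takes its values in \bar R: it is +oo exactly when the
   sequence is not square-summable. *)
Definition l2norm (R : realType) (u : int -> R) : \bar R :=
  ((\esum_(j in [set: int]) (u j ^+ 2)%:E) `^ 2^-1)%E.

Definition in_l2 (R : realType) (u : int -> R) : Prop := (l2norm u < +oo)%E.

Definition cl2norm (R : realType) (z : int -> R[i]) : \bar R :=
  l2norm (fun j => ComplexField.Normc.normc (z j)).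

Definition in_cl2 (R : realType) (z : int -> R[i]) : Prop :=
  (cl2norm z < +oo)%E.

(* The difference quotients of u at t converge to du in the l^2 norm, rather
   than only site by site. *)
Definition is_l2_derive (R : realType) (u : R -> int -> R) (t : R)
    (du : int -> R) : Prop :=
  l2norm (fun j => h^-1 * (u (t + h) j - u t j) - du j) @[h --> 0^'] --> 0%E.

Definition is_cl2_derive (R : realType) (z : R -> int -> R[i]) (t : R)
    (dz : int -> R[i]) : Prop :=
  cl2norm (fun j => (h^-1)%:C%C * (z (t + h) j - z t j) - dz j)
    @[h --> 0^'] --> 0%E.

Definition dot (R : realType) (u : R -> int -> R) (t : R) : int -> R :=
  fun j => derive1 (fun s => u s j) t.

(* The equations are ordinary differential equations in the Banach spaces
   l^2(Z, C) and l^2(Z), holding for all times. *)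
Definition dNLS_solution (R : realType) (eps delta : R)
    (a : R -> int -> R[i]) : Prop :=
  (forall tau, in_cl2 (a tau)) /\
  exists da : R -> int -> R[i],
    (forall tau, is_cl2_derive a tau (da tau)) /\
    forall tau j,
      2 * 'i%C * da tau j
        + 3 * eps%:C%C * delta%:C%C * `|a tau j| ^+ 2 * a tau j
      = a tau (j + 1) + a tau (j - 1)
        + eps%:C%C / 4 * (a tau (j + 2) + 2 * a tau j + a tau (j - 2)).

Definition dKG_solution (R : realType) (eps rho : R)
    (xi : R -> int -> R) : Prop :=
  (forall t, [/\ in_l2 (xi t), in_l2 (dot xi t),
                 is_l2_derive xi t (dot xi t)
               & is_l2_derive (dot xi) t (dot (dot xi) t)]) /\
  forall t j,
    dot (dot xi) t j + xi t j + rho * xi t j ^+ 3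
    = eps * (xi t (j + 1) + xi t (j - 1)).

Definition expi (R : realType) (x : R) : R[i] := (cos x +i* sin x)%C.

(* The expression under complex.Re equals its own conjugate, so taking the
   real part only changes its type. *)
Definition leading_order (R : realType) (eps rho : R) (a : R -> int -> R[i])
    (t : R) : int -> R :=
  fun j => let z := a (eps * t) j in
  complex.Re (z * expi t + z^*%C * expi (- t)
    + 8^-1 * rho%:C%C * (z ^+ 3 * expi (3 * t) + z^*%C ^+ 3 * expi (- (3 * t)))).

(* eps^(3 / (1 + alpha)) << rho(eps) <= eps^2 as eps -> 0+; nothing is asked of
   rho away from 0. *)
Definition asymptotic_range (R : realType) (alpha : R) (rho : R -> R) : Prop :=
  (\forall eps \near 0^'+, 0 < rho eps <= eps ^+ 2) /\
  eps `^ (3 / (1 + alpha)) / rho eps @[eps --> 0^'+] --> (0 : R).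

(* Main.v *)
From HB Require Import structures.
Require Import Defs.
From mathcomp Require Import ring lra.

(** Write a e^{it} = P + iQ. In these coordinates dNLS is autonomous,
    P' = - Q + eps U and Q' = P + eps W, and the approximation
    X = 2 P + rho/4 Re (P + iQ)^3 is a polynomial in P and Q, bounded for all
    times since dNLS conserves the l^2 norm. Instead of X' one uses the
    velocity V = X' - O(eps^3), also polynomial in P and Q; then
    V' = - X + eps (X_{j+1} + X_{j-1}) - rho X^3 + O(eps^3), the terms in
    rho and eps^2 cancelling exactly. For y = xi - X and z = xi' - V, the energy
    E = (|z|^2 + |y|^2 - eps <y, y_{j+1} + y_{j-1}>) / 2 obeys
    |E'| <= c rho (E + E^2) + C eps^6 / rho. Hence E / (1 + E) satisfies a linear
    Gronwall inequality, which needs no a priori smallness of E, and over the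
    times |t| <= A |log rho| / rho the bound grows at most by the factor
    rho^(- c A) <= rho^(- 2 alpha). *)

Set Implicit Arguments.
Unset Strict Implicit.
Unset Printing Implicit Defensive.

Local Open Scope classical_set_scope.
Local Open Scope ring_scope.

(** * Absolutely summable families over the integers *)

Section summation.
Context {R : realType}.
Implicit Types (f g : int -> R) (c : R).

Definition abs_summable f := (\esum_(j in [set: int]) `|f j|%:E < +oo)%E.

(** [fine] sends an infinite sum to 0, so the value is meaningful only for nonnegative summable
    families. *)
Definition nnsum f : R := fine (\esum_(j in [set: int]) (f j)%:E).

(* A junk value is obtained when f is not absolutely summable. *)
Definition zsum f : R := nnsum (fun j => `|f j| + f j) - nnsum (fun j => `|f j|).

Lemma abs_summable_le f g : (forall j, `|f j| <= `|g j|) -> abs_summable g ->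
  abs_summable f.
Proof.
move=> fg; apply: le_lt_trans; apply: le_esum => j _.
by rewrite lee_fin.
Qed.

Lemma abs_summableD f g : abs_summable f -> abs_summable g ->
  abs_summable (fun j => f j + g j).
Proof.
move=> sf sg; apply: le_lt_trans (lte_add_pinfty sf sg).
rewrite -esumD; [|by move=> *; rewrite lee_fin..].
by apply: le_esum => j _; rewrite -EFinD lee_fin ler_normD.
Qed.

Lemma nnsumE f : (forall j, 0 <= f j) -> abs_summable f ->
  (nnsum f)%:E = (\esum_(j in [set: int]) (f j)%:E)%E.
Proof.
move=> f0 sf; rewrite fineK// ge0_fin_numE.
  apply: le_lt_trans sf; apply: le_esum => j _.
  by rewrite lee_fin ler_norm.
by apply: esum_ge0 => j _; rewrite lee_fin.
Qed.

Lemma nnsumD f g : (forall j, 0 <= f j) -> (forall j, 0 <= g j) ->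
  abs_summable f -> abs_summable g ->
  nnsum (fun j => f j + g j) = nnsum f + nnsum g.
Proof.
move=> f0 g0 sf sg; apply: EFin_inj.
rewrite EFinD !nnsumE//; try exact: abs_summableD.
  by rewrite -esumD// => j _; rewrite lee_fin.
by move=> j; rewrite addr_ge0.
Qed.

Lemma nnsum_ge0 f : (forall j, 0 <= f j) -> 0 <= nnsum f.
Proof.
by move=> f0; apply: fine_ge0; apply: esum_ge0 => j _; rewrite lee_fin.
Qed.

Lemma abs_summableZ c f : abs_summable f -> abs_summable (fun j => c * f j).
Proof.
move=> sf.
have s : abs_summable (fun j => `|f j|).
  by apply: abs_summable_le sf => j; rewrite normr_id.
apply: (@le_lt_trans _ _ (`|c| * nnsum (fun j => `|f j|))%:E); last exact: ltry.
apply: ub_ereal_sup => _ /= [A [fA _] <-].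
under eq_fsbigr do rewrite normrM EFinM.
rewrite -ge0_mule_fsumr//.
rewrite EFinM lee_wpmul2l ?lee_fin// nnsumE//.
by apply: ereal_sup_ubound; exists A.
Qed.

Lemma nnsumZ_le c f : 0 <= c -> (forall j, 0 <= f j) -> abs_summable f ->
  nnsum (fun j => c * f j) <= c * nnsum f.
Proof.
move=> c0 f0 sf; rewrite -lee_fin nnsumE;
  [|by move=> j; rewrite mulr_ge0|exact: abs_summableZ].
apply: ub_ereal_sup => _ /= [A [fA _] <-].
under eq_fsbigr do rewrite EFinM.
rewrite -ge0_mule_fsumr//.
rewrite EFinM lee_wpmul2l ?lee_fin// nnsumE//.
by apply: ereal_sup_ubound; exists A.
Qed.

Lemma nnsumZ c f : 0 <= c -> (forall j, 0 <= f j) -> abs_summable f ->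
  nnsum (fun j => c * f j) = c * nnsum f.
Proof.
move=> c0 f0 sf; apply/le_anti/andP; split; first exact: nnsumZ_le.
have [->|cn0] := eqVneq c 0.
  by rewrite mul0r; apply: nnsum_ge0 => j; rewrite mul0r.
rewrite -ler_pdivlMl ?lt_def ?cn0//.
(* The reverse inequality is the one already proved, for the factor [c^-1] and the family
   [c * f j]. *)
rewrite {1}(_ : f = (fun j => c^-1 * (c * f j))); last first.
  by apply/funext => j; rewrite mulKf.
apply: nnsumZ_le; rewrite ?invr_ge0//; last exact: abs_summableZ.
by move=> j; rewrite mulr_ge0.
Qed.

Lemma abs_summable_norm f : abs_summable f -> abs_summable (fun j => `|f j|).
Proof. by apply: abs_summable_le => j; rewrite normr_id. Qed.

Lemma abs_summable_normD f : abs_summable f ->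
  abs_summable (fun j => `|f j| + f j).
Proof. by move=> sf; apply: abs_summableD => //; exact: abs_summable_norm. Qed.

Lemma addr_norm_ge0 (x : R) : 0 <= `|x| + x.
Proof. by rewrite -lerBlDr sub0r -normrN ler_norm. Qed.

Lemma zsumD f g : abs_summable f -> abs_summable g ->
  zsum (fun j => f j + g j) = zsum f + zsum g.
Proof.
move=> sf sg; have sfg := abs_summableD sf sg.
have [[nf ng] nfg] := (abs_summable_norm sf, abs_summable_norm sg,
  abs_summable_norm sfg).
have [[pf pg] pfg] := (abs_summable_normD sf, abs_summable_normD sg,
  abs_summable_normD sfg).
rewrite /zsum.
(* Regrouping |f + g| + f + g + |f| + |g| in two ways gives an identity in which only sums of
   nonnegative families have to be split. *)
pose F j := `|f j + g j| + (f j + g j).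
have : nnsum (fun j => F j + (`|f j| + `|g j|)) =
   nnsum (fun j => `|f j + g j| + ((`|f j| + f j) + (`|g j| + g j))).
  by congr nnsum; apply/funext => j; rewrite /F; ring.
have F0 j : 0 <= F j by exact: addr_norm_ge0.
have f0 j : 0 <= `|f j| + f j by exact: addr_norm_ge0.
have g0 j : 0 <= `|g j| + g j by exact: addr_norm_ge0.
have h0 j : 0 <= `|f j| + `|g j| by exact: addr_ge0.
rewrite (nnsumD F0 h0 pfg (abs_summableD nf ng)).
rewrite (nnsumD _ _ nfg (abs_summableD pf pg))//; last first.
  by move=> j; exact: addr_ge0.
rewrite (nnsumD _ _ nf ng)// (nnsumD f0 g0 pf pg) /F => ?; lra.
Qed.

Lemma ge0_zsum f : (forall j, 0 <= f j) -> abs_summable f -> zsum f = nnsum f.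
Proof.
move=> f0 sf; rewrite /zsum.
have -> : (fun j => `|f j|) = f by apply/funext => j; rewrite ger0_norm.
have -> : (fun j => `|f j| + f j) = (fun j => f j + f j).
  by apply/funext => j; rewrite ger0_norm.
by rewrite nnsumD// addrK.
Qed.

Lemma zsumN f : abs_summable f -> zsum (fun j => - f j) = - zsum f.
Proof.
move=> sf.
have sNf : abs_summable (fun j => - f j).
  by apply: abs_summable_le sf => j; rewrite normrN.
apply/eqP; rewrite -addr_eq0 -zsumD//.
under eq_fun do rewrite addNr.
rewrite ge0_zsum//; last by apply: abs_summable_le sf => j; rewrite normr0.
by rewrite /nnsum esum1.
Qed.

Lemma zsumZ c f : abs_summable f -> zsum (fun j => c * f j) = c * zsum f.
Proof.
wlog c0 : c / 0 <= c => [hw sf|].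
  have [/hw|c0] := leP 0 c; first exact.
  rewrite -[c]opprK mulNr -hw ?oppr_ge0 1?ltW// -zsumN ?abs_summableZ//.
  by congr zsum; apply/funext => j; rewrite mulNr.
move=> sf; rewrite /zsum mulrBr -!nnsumZ//.
- by congr (nnsum _ - nnsum _); apply/funext => j;
    rewrite ?mulrDr normrM (ger0_norm c0).
- exact: abs_summable_norm.
- by move=> j; exact: addr_norm_ge0.
- exact: abs_summable_normD.
Qed.

Lemma zsum_reindex (e : int -> int) f : bijective e ->
  zsum (fun j => f (e j)) = zsum f.
Proof.
move=> be; have e_bij : set_bij [set: int] [set: int] e by rewrite setTT_bijective.
have r g : nnsum (fun j => g (e j)) = nnsum g.
  by rewrite /nnsum [in RHS](@reindex_esum _ _ _ _ _ _ _ e_bij).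
by rewrite /zsum -(r (fun j => `|f j|)) -(r (fun j => `|f j| + f j)).
Qed.

Lemma abs_summable_reindex (e : int -> int) f : bijective e ->
  abs_summable f -> abs_summable (fun j => f (e j)).
Proof.
move=> be; have e_bij : set_bij [set: int] [set: int] e by rewrite setTT_bijective.
by rewrite /abs_summable (@reindex_esum _ _ _ _ _ _ _ e_bij).
Qed.

End summation.

(** * The Hilbert space of square-summable sequences *)

Section l2.
Context {R : realType}.
Implicit Types (f g : int -> R) (c : R).

Lemma in_l2E f : in_l2 f = abs_summable (fun j => f j ^+ 2) :> Prop.
Proof.
rewrite /in_l2 /l2norm /abs_summable.
under [X in _ = is_true (X < _)%E]eq_esum do rewrite ger0_norm ?sqr_ge0//.
apply/propext; split; last exact: poweR_lty.
by apply: lty_poweRy; rewrite invr_eq0.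
Qed.

Lemma in_l2_mul f g : in_l2 f -> in_l2 g -> abs_summable (fun j => f j * g j).
Proof.
rewrite !in_l2E => sf sg; apply: abs_summable_le (abs_summableD sf sg) => j.
rewrite normrM [leRHS]ger0_norm ?addr_ge0 ?sqr_ge0//.
rewrite -(real_normK (num_real (f j))) -(real_normK (num_real (g j))).
have := sqr_ge0 (`|f j| - `|g j|); have := sqr_ge0 (`|f j| + `|g j|).
by move: `|f j| `|g j| => x y; nra.
Qed.

Lemma in_l2D f g : in_l2 f -> in_l2 g -> in_l2 (fun j => f j + g j).
Proof.
move=> lf lg; have sfg := in_l2_mul lf lg.
move: lf lg; rewrite !in_l2E => sf sg.
apply: abs_summable_le
  (abs_summableD (abs_summableD sf sg) (abs_summableZ 2 sfg)) => j.
by rewrite (_ : _ + _ + _ = (f j + g j) ^+ 2)//; ring.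
Qed.

Lemma in_l2Z c f : in_l2 f -> in_l2 (fun j => c * f j).
Proof.
rewrite !in_l2E => sf; under eq_fun do rewrite exprMn.
exact: abs_summableZ.
Qed.

Definition l2_pred : {pred (int -> R)} := fun f => `[< in_l2 f >].

Lemma l2_submod_closed : submod_closed l2_pred.
Proof.
split.
  apply/asboolP; rewrite in_l2E.
  by rewrite /abs_summable esum1// => j _; rewrite expr0n normr0.
move=> c f g /asboolP lf /asboolP lg; apply/asboolP.
exact: in_l2D (in_l2Z c lf) lg.
Qed.

HB.instance Definition _ := GRing.isSubmodClosed.Build R (int -> R) l2_pred
  l2_submod_closed.

End l2.

(** Bundling a sequence with its square-summability gives a type that can carry a normed module
    structure, so that [is_derive] and its rules apply to l^2-valued curves. *)
Record ell2 (R : realType) := Ell2 {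
  ell2_val :> int -> R;
  ell2_valP : ell2_val \in @l2_pred R }.

HB.instance Definition _ (R : realType) := [isSub for @ell2_val R].
HB.instance Definition _ (R : realType) := gen_eqMixin (ell2 R).
HB.instance Definition _ (R : realType) := gen_choiceMixin (ell2 R).
HB.instance Definition _ (R : realType) :=
  [SubChoice_isSubLmodule of ell2 R by <:].

(** * Inner product, norm, pointwise product and shifts *)

Section ell2.
Context {R : realType}.
Implicit Types (u v w : ell2 R) (c : R).
Local Notation V := (ell2 R).

Lemma ell2P u : in_l2 u.
Proof. exact/asboolP/ell2_valP. Qed.

Lemma ell2_eq u v : (forall j, u j = v j) -> u = v.
Proof. by move=> uv; apply/val_inj/funext. Qed.

Lemma ell2D u v j : (u + v : V) j = u j + v j.
Proof. by rewrite -[LHS]/(val (u + v) j) raddfD. Qed.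

Lemma ell2N u j : (- u : V) j = - u j.
Proof. by rewrite -[LHS]/(val (- u) j) raddfN. Qed.

Lemma ell2Z c u j : (c *: u : V) j = c * u j.
Proof. by rewrite -[LHS]/(val (c *: u) j) linearZ. Qed.

Lemma ell20 j : (0 : V) j = 0.
Proof. by rewrite -[LHS]/(val (0 : V) j) raddf0. Qed.

Definition mk_ell2 (f : int -> R) (lf : in_l2 f) : V := Ell2 (introT (asboolP _) lf).

Definition ip u v := zsum (fun j => u j * v j).

Lemma summable_ip u v : abs_summable (fun j => u j * v j).
Proof. exact: in_l2_mul (ell2P u) (ell2P v). Qed.

Lemma ipC u v : ip u v = ip v u.
Proof. by congr zsum; apply/funext => j; rewrite mulrC. Qed.

Lemma ipDl u v w : ip (u + v) w = ip u w + ip v w.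
Proof.
rewrite /ip -zsumD; try exact: summable_ip.
by congr zsum; apply/funext => j; rewrite ell2D mulrDl.
Qed.

Lemma ipZl c u v : ip (c *: u) v = c * ip u v.
Proof.
rewrite /ip -zsumZ; last exact: summable_ip.
by congr zsum; apply/funext => j; rewrite ell2Z mulrA.
Qed.

Lemma ipDr u v w : ip u (v + w) = ip u v + ip u w.
Proof. by rewrite ipC ipDl !(ipC u). Qed.

Lemma ipZr c u v : ip u (c *: v) = c * ip u v.
Proof. by rewrite ipC ipZl ipC. Qed.

Lemma ipNl u v : ip (- u) v = - ip u v.
Proof. by rewrite -scaleN1r ipZl mulN1r. Qed.

Lemma ipNr u v : ip u (- v) = - ip u v.
Proof. by rewrite ipC ipNl ipC. Qed.

Lemma ip_ge0 u : 0 <= ip u u.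
Proof.
rewrite /ip ge0_zsum; last exact: summable_ip.
  by apply: nnsum_ge0 => j; rewrite -expr2 sqr_ge0.
by move=> j; rewrite -expr2 sqr_ge0.
Qed.

Lemma sqr_le_ip u j : u j ^+ 2 <= ip u u.
Proof.
have u0 i : 0 <= u i * u i by rewrite -expr2 sqr_ge0.
rewrite /ip ge0_zsum//; last exact: summable_ip.
rewrite -lee_fin nnsumE//; last exact: summable_ip.
apply: esum_ge; exists [set j]; first by split=> //; exact: finite_set1.
by rewrite fsbig_set1 expr2.
Qed.

Lemma ip_le u v : (forall j, `|u j| <= `|v j|) -> ip u u <= ip v v.
Proof.
move=> uv; have w0 w i : 0 <= w i * w i by rewrite -expr2 sqr_ge0.
rewrite /ip !ge0_zsum//; try exact: summable_ip.
rewrite -lee_fin !nnsumE//; try exact: summable_ip.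
apply: le_esum => j _; rewrite lee_fin -!expr2.
by rewrite -(real_normK (num_real (u j))) -(real_normK (num_real (v j))) lerXn2r// nnegrE.
Qed.

Definition ell2_norm u := Num.sqrt (ip u u).

Lemma ell2_norm_ge0 u : 0 <= ell2_norm u.
Proof. exact: sqrtr_ge0. Qed.

Lemma sqr_ell2_norm u : ell2_norm u ^+ 2 = ip u u.
Proof. by rewrite sqr_sqrtr// ip_ge0. Qed.

Lemma ell2_normZ c u : ell2_norm (c *: u) = `|c| * ell2_norm u.
Proof.
by rewrite /ell2_norm ipZl ipZr mulrA -expr2 sqrtrM ?sqr_ge0// sqrtr_sqr.
Qed.

Lemma ell2_norm_eq0 u : ell2_norm u = 0 -> u = 0.
Proof.
move=> u0; apply: ell2_eq => j; apply/eqP; rewrite ell20 -sqrf_eq0.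
by rewrite eq_le sqr_ge0 andbT (le_trans (sqr_le_ip u j))// -sqr_ell2_norm u0 expr0n.
Qed.

(** Expand the nonnegative square of |v| u - |u| v and divide by |u| |v|; vanishing norms are
    treated first to allow the division. *)
Lemma ip_cauchy u v : ip u v <= ell2_norm u * ell2_norm v.
Proof.
have [/eqP u0|u0] := boolP (ell2_norm u == 0).
  have -> : u = 0 *: 0 by rewrite (ell2_norm_eq0 u0) scaler0.
  by rewrite ipZl mul0r mulr_ge0 ?ell2_norm_ge0.
have [/eqP v0|v0] := boolP (ell2_norm v == 0).
  have -> : v = 0 *: 0 by rewrite (ell2_norm_eq0 v0) scaler0.
  by rewrite ipZr mul0r mulr_ge0 ?ell2_norm_ge0.
have up : 0 < ell2_norm u by rewrite lt_def u0 ell2_norm_ge0.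
have vp : 0 < ell2_norm v by rewrite lt_def v0 ell2_norm_ge0.
have := ip_ge0 (ell2_norm v *: u - ell2_norm u *: v).
rewrite !(ipDl, ipDr, ipNl, ipNr, ipZl, ipZr) (ipC v u) -!sqr_ell2_norm => h.
rewrite -(ler_pM2l (mulr_gt0 up vp)).
move: h; move: (ip u v) (ell2_norm u) (ell2_norm v) => x a b.
by nra.
Qed.

Lemma ell2_normD u v : ell2_norm (u + v) <= ell2_norm u + ell2_norm v.
Proof.
rewrite -(@ler_pXn2r _ 2)// ?nnegrE ?addr_ge0 ?ell2_norm_ge0//.
rewrite sqr_ell2_norm !(ipDl, ipDr) (ipC v u) sqrrD !sqr_ell2_norm.
have := ip_cauchy u v; lra.
Qed.

HB.instance Definition _ := Lmodule_isNormed.Build R V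
  ell2_normD ell2_normZ ell2_norm_eq0.

Lemma sqr_normE u : `|u| ^+ 2 = ip u u.
Proof. exact: sqr_ell2_norm. Qed.

Lemma normr_ip u v : `|ip u v| <= `|u| * `|v|.
Proof.
rewrite ler_norml; apply/andP; split; last exact: ip_cauchy.
by rewrite lerNl -ipNl -(normrN u); exact: ip_cauchy.
Qed.

Lemma normr_coord u j : `|u j| <= `|u|.
Proof.
by rewrite -sqrtr_sqr ler_sqrt ?ip_ge0// sqr_le_ip.
Qed.

Lemma ell2_norm_le u v : (forall j, `|u j| <= `|v j|) -> `|u| <= `|v|.
Proof. by move=> uv; rewrite ler_sqrt ?ip_ge0// ip_le. Qed.

Lemma l2normE u : l2norm u = `|u|%:E.
Proof.
rewrite /l2norm poweR12_sqrt; last by apply: esum_ge0 => j _; rewrite lee_fin sqr_ge0.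
rewrite [`|u|]/(ell2_norm u) /ell2_norm /ip ge0_zsum; last exact: summable_ip.
  under eq_esum do rewrite expr2.
  rewrite -nnsumE//; [|exact: summable_ip].
  by move=> j; rewrite -expr2 sqr_ge0.
by move=> j; rewrite -expr2 sqr_ge0.
Qed.

(** A square-summable sequence is bounded by its norm, so multiplication by it preserves l^2. *)
Lemma in_l2_mulfg u v : in_l2 (fun j => u j * v j).
Proof.
rewrite in_l2E; apply: abs_summable_le (abs_summableZ (`|u| ^+ 2) (summable_ip v v)) => j.
have [u0 v0] := (sqr_ge0 (u j), sqr_ge0 (v j)).
rewrite exprMn -[v j * v j]expr2 [leLHS](ger0_norm (mulr_ge0 u0 v0)).
by rewrite (ger0_norm (mulr_ge0 (sqr_ge0 _) v0)) ler_wpM2r// sqr_normE sqr_le_ip.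
Qed.

Definition emul u v : V := mk_ell2 (in_l2_mulfg u v).

Lemma emulE u v j : emul u v j = u j * v j. Proof. by []. Qed.

(** Entrywise comparison with [|u| *: v]. This submultiplicativity controls every cubic term
    below. *)
Lemma normr_emul u v : `|emul u v| <= `|u| * `|v|.
Proof.
have -> : `|u| * `|v| = `| `|u| *: v | by rewrite normrZ normr_id.
apply: ell2_norm_le => j; rewrite emulE ell2Z !normrM normr_id.
by rewrite ler_wpM2r// normr_coord.
Qed.

Lemma in_l2_reindex (e : int -> int) u : bijective e -> in_l2 (fun j => u (e j)).
Proof.
move=> be; rewrite in_l2E.
exact: (abs_summable_reindex be (f := fun j => u j ^+ 2)) (summable_ip u u).
Qed.

Lemma bij_addz (k : int) : bijective (fun j : int => j + k).
Proof. by exists (fun j => j - k) => j; rewrite ?addrK ?subrK. Qed.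

Definition eshift (k : int) u : V := mk_ell2 (in_l2_reindex u (bij_addz k)).

Lemma eshiftE k u j : eshift k u j = u (j + k). Proof. by []. Qed.

Lemma ip_eshift k u v : ip (eshift k u) (eshift k v) = ip u v.
Proof.
by rewrite /ip -[RHS](zsum_reindex _ (bij_addz k)).
Qed.

Lemma normr_eshift k u : `|eshift k u| = `|u|.
Proof. by congr Num.sqrt; exact: ip_eshift. Qed.

Definition nbr u : V := eshift 1 u + eshift (- 1) u.

Lemma nbrE u j : nbr u j = u (j + 1) + u (j - 1).
Proof. by rewrite ell2D. Qed.

Lemma normr_nbr u : `|nbr u| <= 2 * `|u|.
Proof. by rewrite (le_trans (ler_normD _ _))// !normr_eshift; lra. Qed.

(** The inner product is shift invariant, so the shifts by 1 and -1 are adjoint to each other and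
    their sum is self-adjoint. *)
Lemma ip_nbr u v : ip (nbr u) v = ip u (nbr v).
Proof.
have K1 w : eshift (- 1) (eshift 1 w) = w.
  by apply: ell2_eq => j; rewrite !eshiftE subrK.
have K2 w : eshift 1 (eshift (- 1) w) = w.
  by apply: ell2_eq => j; rewrite !eshiftE addrK.
rewrite ipDl ipDr -(ip_eshift (- 1) (eshift 1 u)) K1.
by rewrite -(ip_eshift 1 (eshift (- 1) u)) K2 addrC.
Qed.

End ell2.

(** * Derivatives of vector-valued functions *)

Section vector_derivatives.
Context {R : realType}.
Implicit Types (U V W : normedModType R) (t : R).

Lemma is_deriveP W (f : R -> W) t d :
  is_derive t 1 f d <-> (h^-1 *: (f (t + h) - f t) @[h --> 0^'] --> d).
Proof.
rewrite (_ : (fun h => h^-1 *: (f (t + h) - f t)) =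
  (fun h : R => h^-1 *: ((f \o shift t) (h *: 1) - f t))); last first.
  by apply/funext => h; rewrite /= /GRing.scale/= mulr1 (addrC h).
split=> [[fd <-]//|fd]; apply: DeriveDef; first by apply/cvg_ex; exists d.
exact: cvg_lim fd.
Qed.

Lemma is_derive_fD W (f g : R -> W) t df dg :
  is_derive t 1 f df -> is_derive t 1 g dg ->
  is_derive t 1 (fun s => f s + g s) (df + dg).
Proof. by move=> fd gd; have := is_deriveD fd gd. Qed.

Lemma is_derive_fB W (f g : R -> W) t df dg :
  is_derive t 1 f df -> is_derive t 1 g dg ->
  is_derive t 1 (fun s => f s - g s) (df - dg).
Proof. by move=> fd gd; have := is_deriveB fd gd. Qed.

Lemma is_derive_fZ W (f : R -> W) k t df :
  is_derive t 1 f df -> is_derive t 1 (fun s => k *: f s) (k *: df).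
Proof. by move=> fd; have := is_deriveZ k fd. Qed.

Lemma is_derive_cvg W (f : R -> W) t d :
  is_derive t 1 f d -> f (t + h) @[h --> 0^'] --> f t.
Proof.
move=> /is_deriveP fd.
have -> : f t = 0 *: d + f t by rewrite scale0r add0r.
have : h *: (h^-1 *: (f (t + h) - f t)) + f t @[h --> 0^'] --> 0 *: d + f t.
  apply: cvgD; last exact: cvg_cst.
  by apply: cvgZ => //; apply: cvg_within.
apply: cvg_trans; apply: near_eq_cvg; near=> h.
have h0 : h != 0 by near: h; exact: nbhs_dnbhs_neq.
by rewrite scalerA divff// scale1r subrK.
Unshelve. all: by end_near. Qed.

(** Product rule for bounded bilinear maps; scaling, pointwise product and inner product are
    instances. Additivity is stated for differences, the form in which difference quotients use
    it. *)
Lemma is_derive_bilin U V W (B : U -> V -> W) (C : R) (u : R -> U) (v : R -> V)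
    t du dv :
  (forall x y z, B (x - y) z = B x z - B y z) ->
  (forall x y z, B x (y - z) = B x y - B x z) ->
  (forall c x y, B (c *: x) y = c *: B x y) ->
  (forall c x y, B x (c *: y) = c *: B x y) ->
  (forall x y, `|B x y| <= C * (`|x| * `|y|)) ->
  is_derive t 1 u du -> is_derive t 1 v dv ->
  is_derive t 1 (fun s => B (u s) (v s)) (B du (v t) + B (u t) dv).
Proof.
move=> Bl Br Zl Zr BC ud vd; apply/is_deriveP.
(* Joint continuity of [B]: the increment telescopes into [B (x_ h - x) (y_ h) + B x (y_ h - y)]. *)
have cB (x_ : R -> U) (y_ : R -> V) x y :
    x_ h @[h --> 0^'] --> x -> y_ h @[h --> 0^'] --> y ->
    B (x_ h) (y_ h) @[h --> 0^'] --> B x y.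
  move=> xx yy; apply/subr_cvg0; apply/norm_cvg0P.
  pose bound h := C * (`|x_ h - x| * `|y_ h|) + C * (`|x| * `|y_ h - y|).
  apply: (@squeeze_cvgr _ _ _ _ (cst 0) bound); last 2 first.
  - exact: cvg_cst.
  - have z0 : C * (0 * `|y|) + C * (`|x| * 0) = 0 by rewrite !(mul0r, mulr0) addr0.
    rewrite -[X in _ --> X]z0.
    apply: cvgD; apply: cvgMr; apply: cvgM.
    + by apply/norm_cvg0P/subr_cvg0.
    + exact: cvg_norm.
    + exact: cvg_cst.
    + by apply/norm_cvg0P/subr_cvg0.
  near=> h; rewrite normr_ge0/= /bound.
  rewrite (_ : _ - _ = B (x_ h - x) (y_ h) + B x (y_ h - y)).
    by rewrite (le_trans (ler_normD _ _))// lerD.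
  by rewrite Bl Br addrA subrK.
have vc := is_derive_cvg vd.
move/is_deriveP in ud; move/is_deriveP in vd.
(* The quotient is split with [v] taken at [t + h] in the first term, hence the need for continuity
   of [v] at [t]. *)
pose q h := B (h^-1 *: (u (t + h) - u t)) (v (t + h)) + B (u t) (h^-1 *: (v (t + h) - v t)).
have qc : q h @[h --> 0^'] --> B du (v t) + B (u t) dv.
  exact: cvgD (cB _ _ _ _ ud vc) (cB _ _ _ _ (cvg_cst (u t)) vd).
apply: cvg_trans qc; apply: near_eq_cvg; near=> h; rewrite /q.
by rewrite /= Zl Zr -scalerDr Bl Br addrA subrK.
Unshelve. all: by end_near. Qed.

(** [T] is seen as the bilinear map sending (c, x) to [c *: T x], along the constant scalar curve
    1. *)
Lemma is_derive_lin V W (T : V -> W) (C : R) (v : R -> V) t dv :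
  (forall x y, T (x - y) = T x - T y) ->
  (forall c x, T (c *: x) = c *: T x) ->
  (forall x, `|T x| <= C * `|x|) ->
  is_derive t 1 v dv -> is_derive t 1 (fun s => T (v s)) (T dv).
Proof.
move=> TB TZ TC vd.
suff : is_derive t 1 (fun s => (1 : R^o) *: T (v s)) (0 *: T (v t) + 1 *: T dv).
  by under eq_fun do rewrite scale1r; rewrite scale0r add0r scale1r.
apply: (@is_derive_bilin R^o V W (fun c x => c *: T x) C (cst 1)) => //.
- by move=> *; rewrite scalerBl.
- by move=> *; rewrite TB scalerBr.
- by move=> *; rewrite scalerA.
- by move=> *; rewrite TZ !scalerA mulrC.
- by move=> x y; rewrite normrZ mulrCA ler_wpM2l.
Qed.

Lemma is_derive_scal V (c : R -> R) (v : R -> V) t dc dv :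
  is_derive t 1 c dc -> is_derive t 1 v dv ->
  is_derive t 1 (fun s => c s *: v s) (dc *: v t + c t *: dv).
Proof.
apply: (@is_derive_bilin R^o V V (fun c x => c *: x) 1).
- by move=> *; rewrite scalerBl.
- by move=> *; rewrite scalerBr.
- by move=> *; rewrite scalerA.
- by move=> *; rewrite !scalerA mulrC.
- by move=> *; rewrite normrZ mul1r.
Qed.

(** Serves the passage from the slow time [tau = eps * t] to [t]. *)
Lemma is_derive_dilate V (k : R) (v : R -> V) t dv :
  is_derive (k * t) 1 v dv -> is_derive t 1 (fun s => v (k * s)) (k *: dv).
Proof.
move=> [vd <-].
have kd : differentiable ( *%R k) t by [].
have vdif : differentiable v (k * t) by apply/derivable1_diffP.
have cd : differentiable (v \o ( *%R k)) t by exact: differentiable_comp.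
apply: (@DeriveDef _ _ _ _ _ (v \o ( *%R k))); first exact/derivable1_diffP.
rewrite deriveE// diff_comp//= deriveE//.
have -> : 'd ( *%R k) t 1 = k *: 1.
  by rewrite -deriveE//; apply: derive_val.
exact: linearZ.
Qed.

End vector_derivatives.

(** * A Gronwall inequality with a quadratic term *)

Section comparison.
Context {R : realType}.

(** With w = E / (1 + E), dividing the rate bound by (1 + E)^2 gives w' <= c w + b. Linear Gronwall
    bounds w, and as long as this bound is at most 1/2, solving for E costs only a factor 2. *)
Lemma log_gronwall (E dE : R -> R) (c b : R) :
  (forall t, is_derive t (1 : R) E (dE t)) -> (forall t, 0 <= E t) ->
  (forall t, `|dE t| <= c * (E t + E t ^+ 2) + b) -> 0 < c -> 0 <= b ->
  forall t, expR (c * `|t|) * (E 0 + b / c) <= 2^-1 ->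
  E t <= 2 * (expR (c * `|t|) * (E 0 + b / c)).
Proof.
(* Negative times follow by time reversal, which preserves the two-sided bound on the rate. *)
suff main (F dF : R -> R) :
    (forall t, is_derive t (1 : R) F (dF t)) -> (forall t, 0 <= F t) ->
    (forall t, `|dF t| <= c * (F t + F t ^+ 2) + b) -> 0 < c -> 0 <= b ->
    forall t, 0 <= t -> expR (c * t) * (F 0 + b / c) <= 2^-1 ->
    F t <= 2 * (expR (c * t) * (F 0 + b / c)).
  move=> Ed E0 dEb c0 b0 t.
  have [t0|t0] := leP 0 t; first by rewrite ger0_norm//; exact: main.
  rewrite ltr0_norm// => tb.
  have := main (E \o -%R) (fun s => - dE (- s)) _ _ _ c0 b0 (- t).
  rewrite /= opprK oppr0; apply => //.
  - move=> s; rewrite -mulrN1.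
    by apply: is_derive1_comp; apply: is_derive_eq.
  - by move=> s; rewrite normrN.
  - by rewrite oppr_ge0 ltW.
move=> Fd F0 dFb c0 b0 t t0 small.
have F1 s : 0 < 1 + F s by rewrite ltr_wpDr.
pose w s := 1 - (1 + F s)^-1.
(* With this integrating factor the inequality for [w] becomes monotonicity of [G]. *)
pose G s := expR (- (c * s)) * (w s + b / c).
have Gd s : is_derive s (1 : R) G
   (- c * expR (- (c * s)) * (w s + b / c) + expR (- (c * s)) * (dF s / (1 + F s) ^+ 2)).
  have F1d : is_derive s (1 : R) (fun x => 1 + F x) (0 + dF s).
    exact: is_derive_fD (is_derive_cst _ _ _) (Fd s).
  have wd : is_derive s (1 : R) w (0 - (- (1 + F s) ^- 2 *: (0 + dF s))).
    have n0 : 1 + F s != 0 by rewrite gt_eqF.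
    have Vd := @is_deriveV R (fun x => 1 + F x) s _ 1 n0 F1d.
    exact: (is_derive_fB (is_derive_cst (1 : R) s (1 : R)) Vd).
  have ed : is_derive s (1 : R) (fun x => expR (- (c * x)))
      (expR (- (c * s)) * - (c *: 1)).
    have cd : is_derive s (1 : R) (fun x => - (c * x)) (- (c *: 1)).
      by have := is_deriveN (is_deriveZ c (is_derive_id s (1 : R))).
    exact: (is_derive1_comp (is_derive_expR _) cd).
  have Gd := is_deriveM ed (is_derive_fD wd (is_derive_cst (b / c) s (1 : R))).
  apply: is_derive_eq Gd _.
  by rewrite /GRing.scale/= /w; field; rewrite !gt_eqF.
have dG s : derive1 G s <= 0.
  rewrite derive1E derive_val.
  rewrite [leLHS](_ : _ =
    expR (- (c * s)) * (dF s / (1 + F s) ^+ 2 - c * w s - b)); last first.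
    by field; rewrite !gt_eqF.
  rewrite pmulr_rle0 ?expR_gt0// !lerBlDr add0r ler_pdivrMr ?exprn_gt0//.
  rewrite (le_trans (ler_norm _))// (le_trans (dFb s))//.
  rewrite [leRHS](_ : _ = c * (F s + F s ^+ 2) + b * (1 + F s) ^+ 2); last first.
    by rewrite /w; field; rewrite gt_eqF.
  by rewrite lerD2l ler_peMr// exprn_ege1// lerDl.
have Gt : G t <= G 0.
  apply: (@ler0_derive1_nincry _ G 0) => //.
  apply: continuous_subspaceT => x.
  by apply/differentiable_continuous/derivable1_diffP.
move: Gt; rewrite /G mulr0 oppr0 expR0 mul1r expRN ler_pdivrMl ?expR_gt0// => Gt.
have bc : 0 <= b / c by rewrite divr_ge0// ltW.
have w0 : w 0 <= F 0.
  rewrite /w lerBlDr -lerBlDl -(ler_pM2r (F1 0)) mulVf ?gt_eqF//.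
  by have := F0 0; nra.
set B := _ * _ in small *.
have wB : w t <= B.
  rewrite -[w t]addr0 (le_trans (lerD (lexx _) bc))// (le_trans Gt)// /B.
  by rewrite ler_wpM2l ?expR_ge0// lerD2r.
(* This is [w t <= B] cleared of its denominator; [B <= 2^-1] then yields [F t <= 2 * B]. *)
have : F t <= B * (1 + F t).
  rewrite -ler_pdivrMr//; apply: le_trans wB; rewrite /w le_eqVlt; apply/orP; left.
  by apply/eqP; field; rewrite gt_eqF.
have := F0 t; nra.
Qed.

End comparison.

(** * Calculus of l^2-valued curves *)

Section ell2_calculus.
Context {R : realType}.
Local Notation V := (ell2 R).
Implicit Types (u v w : R -> V) (t : R).

Definition ell2E := (@ell2D R, @ell2N R, @ell2Z R, @ell20 R, @nbrE R, @emulE R).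

Lemma nbrD (x y : V) : nbr (x + y) = nbr x + nbr y.
Proof. by apply: ell2_eq => j; rewrite !ell2E addrACA. Qed.

Lemma nbrN (x : V) : nbr (- x) = - nbr x.
Proof. by apply: ell2_eq => j; rewrite !ell2E opprD. Qed.

Lemma nbrZ c (x : V) : nbr (c *: x) = c *: nbr x.
Proof. by apply: ell2_eq => j; rewrite !ell2E mulrDr. Qed.

Lemma is_derive_nbr u t du :
  is_derive t 1 u du -> is_derive t 1 (fun s => nbr (u s)) (nbr du).
Proof.
apply: (@is_derive_lin R V V (@nbr R) 2) => *; last exact: normr_nbr.
  by rewrite nbrD nbrN.
exact: nbrZ.
Qed.

Lemma is_derive_emul u v t du dv : is_derive t 1 u du -> is_derive t 1 v dv ->
  is_derive t 1 (fun s => emul (u s) (v s)) (emul du (v t) + emul (u t) dv).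
Proof.
apply: (@is_derive_bilin R V V V (@emul R) 1) => *.
- by apply: ell2_eq => j; rewrite !ell2E mulrBl.
- by apply: ell2_eq => j; rewrite !ell2E mulrBr.
- by apply: ell2_eq => j; rewrite !ell2E mulrA.
- by apply: ell2_eq => j; rewrite !ell2E mulrCA.
- by rewrite mul1r normr_emul.
Qed.

Lemma is_derive_ip u v t du dv : is_derive t 1 u du -> is_derive t 1 v dv ->
  is_derive t 1 (fun s => ip (u s) (v s)) (ip du (v t) + ip (u t) dv).
Proof.
apply: (@is_derive_bilin R V V R^o (@ip R) 1) => *.
- by rewrite ipDl ipNl.
- by rewrite ipDr ipNr.
- exact: ipZl.
- exact: ipZr.
- by rewrite mul1r normr_ip.
Qed.

Lemma is_derive_coord u t du j :
  is_derive t 1 u du -> is_derive t 1 (fun s => u s j) (du j).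
Proof.
apply: (@is_derive_lin R V R^o (fun x => x j) 1) => *.
- by rewrite !ell2E.
- by rewrite !ell2E.
- by rewrite mul1r normr_coord.
Qed.

Lemma is_derive_of_l2 u t (du : V) : is_l2_derive (fun s => u s : int -> R) t du ->
  is_derive t 1 u du.
Proof.
move=> ud; apply/is_deriveP/subr_cvg0/norm_cvg0P.
apply: cvg_trans (fine_cvg ud); apply: near_eq_cvg; apply: nearW => h /=.
by rewrite -[RHS]/(fine `|_|%:E) -l2normE.
Qed.

End ell2_calculus.

(** * The dNLS equation in real form and its conserved mass *)

Section dNLS.
Context {R : realType}.
Local Notation V := (ell2 R).
Implicit Types (p q : V) (eps kappa : R).

(** The linear right-hand side of dNLS: [nbr (nbr p)] has entries p_{j+2} + 2 p_j + p_{j-2}. *)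
Definition hop eps p : V := nbr p + (eps / 4) *: nbr (nbr p).

(** For z = p + iq, [cub p q] and [cub q p] are the real and imaginary parts of |z|^2 z. *)
Definition cub p q : V := emul (emul p p + emul q q) p.

Lemma ip_hop eps p q : ip (hop eps p) q = ip p (hop eps q).
Proof. by rewrite /hop ipDl ipDr ipZl ipZr !ip_nbr. Qed.

Lemma ip_cub p q : ip p (cub q p) = ip q (cub p q).
Proof.
by congr zsum; apply/funext => j; rewrite /cub !ell2E; ring.
Qed.

(** Real and imaginary parts of dNLS for a = p + iq; [kappa] stands for [3 * eps * delta]. *)
Definition dNLS_real_solution eps kappa (p q : R -> V) : Prop := forall tau : R,
  is_derive tau (1 : R) p (2^-1 *: (hop eps (q tau) - kappa *: cub (q tau) (p tau))) /\
  is_derive tau (1 : R) q (- 2^-1 *: (hop eps (p tau) - kappa *: cub (p tau) (q tau))).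

(** In the derivative of the mass the linear terms cancel because [hop] is self-adjoint, the cubic
    ones because both equal the sum of |a|^2 p q. *)
Lemma dNLS_mass eps kappa (p q : R -> V) tau : dNLS_real_solution eps kappa p q ->
  `|p tau| ^+ 2 + `|q tau| ^+ 2 = `|p 0| ^+ 2 + `|q 0| ^+ 2.
Proof.
move=> pq; rewrite !sqr_normE.
apply: (is_derive_0_is_cst (f := fun s => ip (p s) (p s) + ip (q s) (q s))) => s.
have [pd qd] := pq s.
apply: is_derive_eq (is_derive_fD (is_derive_ip pd pd) (is_derive_ip qd qd)) _.
have ipB (x y z : V) : ip x (y - z) = ip x y - ip x z by rewrite ipDr ipNr.
rewrite (ipC (_ *: _) (p s)) (ipC (_ *: _) (q s)) !(ipZr _ (p s), ipZr _ (q s)) !ipB.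
rewrite !(ipZr _ (p s), ipZr _ (q s)).
by rewrite ip_cub -(ip_hop _ (p s)) (ipC (hop _ (p s))); ring.
Qed.

End dNLS.

(** * The approximation and its residual *)

(* Syntactic matching: rewriting with the multirule [ell2E] unfolds every
   nested sequence it fails to match. *)
Ltac nbr_expand := repeat match goal with
  | |- context [nbr (?a + ?b)] => rewrite (nbrD a b)
  | |- context [nbr (- ?a)] => rewrite (nbrN a)
  | |- context [nbr (?c *: ?a)] => rewrite (nbrZ c a)
  end.

Ltac ell2_eval := repeat match goal with
  | |- context [ell2_val (?a + ?b) ?j] => rewrite (ell2D a b j)
  | |- context [ell2_val (- ?a) ?j] => rewrite (ell2N a j)
  | |- context [ell2_val (?c *: ?a) ?j] => rewrite (ell2Z c a j)
  | |- context [ell2_val (emul ?a ?b) ?j] => rewrite (emulE a b j)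
  end.

Section approximation.
Context {R : realType}.
Local Notation V := (ell2 R).
Implicit Types (eps delta : R) (P Q : V).

Lemma hopD eps P Q : hop eps (P + Q) = hop eps P + hop eps Q.
Proof. by rewrite /hop !nbrD scalerDr addrACA. Qed.

Lemma hopZ eps c P : hop eps (c *: P) = c *: hop eps P.
Proof. by apply: ell2_eq => j; rewrite /hop !ell2E; ring. Qed.

Lemma hopN eps P : hop eps (- P) = - hop eps P.
Proof. by rewrite -scaleN1r hopZ scaleN1r. Qed.

Lemma is_derive_hop eps (u : R -> V) (t : R) du :
  is_derive t 1 u du -> is_derive t 1 (fun s => hop eps (u s)) (hop eps du).
Proof.
move=> ud; apply: is_derive_fD; first exact: is_derive_nbr.
by apply: is_derive_fZ; do 2 apply: is_derive_nbr.
Qed.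

(** With z = P + iQ, [slow_re] and [slow_im] are the real and imaginary parts of -(i/2) (hop z - 3
    eps delta |z|^2 z), the slow-time velocity given by dNLS. *)
Definition slow_re eps delta P Q : V :=
  2^-1 *: (hop eps Q - (3 * eps * delta) *: cub Q P).

Definition slow_im eps delta P Q : V :=
  - 2^-1 *: (hop eps P - (3 * eps * delta) *: cub P Q).

(* The factor [expi t] is absorbed in P + iQ, which turns the dNLS equation
   into an autonomous one. *)
Definition rotating_solution eps delta (P Q : R -> V) : Prop := forall t : R,
  is_derive t (1 : R) P (- Q t + eps *: slow_re eps delta (P t) (Q t)) /\
  is_derive t (1 : R) Q (P t + eps *: slow_im eps delta (P t) (Q t)).

(** Gauge invariance: multiplying z by the unit number c + is leaves |z|^2 unchanged, so |z|^2 z is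
    multiplied by c + is too. *)
Lemma cub_rot c s P Q : c ^+ 2 + s ^+ 2 = 1 ->
  cub (c *: P - s *: Q) (s *: P + c *: Q) = c *: cub P Q - s *: cub Q P.
Proof.
move=> cs; apply: ell2_eq => j; rewrite /cub !ell2E.
move: (P j) (Q j) => x y.
transitivity ((c ^+ 2 + s ^+ 2) * (x ^+ 2 + y ^+ 2) * (c * x - s * y)); first ring.
by rewrite cs; ring.
Qed.

Lemma cub_rot' c s P Q : c ^+ 2 + s ^+ 2 = 1 ->
  cub (s *: P + c *: Q) (c *: P - s *: Q) = s *: cub P Q + c *: cub Q P.
Proof.
move=> cs; apply: ell2_eq => j; rewrite /cub !ell2E.
move: (P j) (Q j) => x y.
transitivity ((c ^+ 2 + s ^+ 2) * (x ^+ 2 + y ^+ 2) * (s * x + c * y)); first ring.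
by rewrite cs; ring.
Qed.

Lemma dNLS_rotating eps delta (p q : R -> V) :
  dNLS_real_solution eps (3 * eps * delta) p q ->
  rotating_solution eps delta
    (fun t => cos t *: p (eps * t) - sin t *: q (eps * t))
    (fun t => sin t *: p (eps * t) + cos t *: q (eps * t)).
Proof.
move=> pq t; have [/is_derive_dilate pd /is_derive_dilate qd] := pq (eps * t).
have [cd sd] := (is_derive_cos t, is_derive_sin t).
have cs := cos2Dsin2 t.
rewrite /slow_re /slow_im (cub_rot _ _ cs) (cub_rot' _ _ cs).
rewrite !hopD !hopN !hopZ; split.
  apply: is_derive_eq (is_derive_fB (is_derive_scal cd pd) (is_derive_scal sd qd)) _.
  by apply: ell2_eq => j; ell2_eval; ring.
apply: is_derive_eq (is_derive_fD (is_derive_scal sd pd) (is_derive_scal cd qd)) _.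
by apply: ell2_eq => j; ell2_eval; ring.
Qed.

(** [re3] and [im3] are the real and imaginary parts of (P + iQ)^3. *)
Definition re3 P Q : V := emul (emul P P - 3 *: emul Q Q) P.
Definition im3 P Q : V := emul (3 *: emul P P - emul Q Q) Q.

Definition appr eps delta P Q : V :=
  2 *: P + (eps ^+ 2 * delta / 4) *: re3 P Q.

(** The derivative of 2 P is kept entirely; in that of the cubic correction only the rotation z' =
    iz is kept, which turns Re z^3 into -3 Im z^3. What is dropped is [eps ^+ 3 *: res_pos]. *)
Definition appr_vel eps delta P Q : V :=
  - (2 *: Q) + eps *: hop eps Q - (3 * (eps ^+ 2 * delta)) *: cub Q P
  - (3 * (eps ^+ 2 * delta) / 4) *: im3 P Q.

Definition res_pos eps delta P Q : V :=
  let U := slow_re eps delta P Q in let W := slow_im eps delta P Q in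
  delta *: ((3 / 4) *: emul (emul P P - emul Q Q) U
            - (6 / 4) *: emul (emul P Q) W).

(** The powers of [nbr] are what remains of eps^2 (nbr nbr P - hop hop P) / 2. The terms with a
    single [delta] come from slow derivatives of the corrections and from [nbr] acting on the cubic
    part of X. The last term is X^3 - (2 P)^3, factored through X - 2 P. *)
Definition res_vel eps delta P Q : V :=
  let U := slow_re eps delta P Q in let W := slow_im eps delta P Q in
  let X := appr eps delta P Q in
  - (4^-1 *: nbr (nbr (nbr P))) - eps *: (32^-1 *: nbr (nbr (nbr (nbr P))))
  + delta *: ((3 / 2) *: hop eps (cub P Q)
     - (6 *: emul (emul P U + emul Q W) Q + 3 *: emul (emul P P + emul Q Q) W)
     - (18 / 4) *: emul (emul P Q) U
     - (9 / 4) *: emul (emul P P - emul Q Q) W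
     - 4^-1 *: nbr (re3 P Q))
  + eps *: (delta *: (delta *: (4^-1 *:
       emul (re3 P Q) (emul X X + 2 *: emul X P + 4 *: emul P P)))).

Definition kg_force eps delta (x : V) : V :=
  - x + eps *: nbr x - (eps ^+ 2 * delta) *: emul (emul x x) x.

Lemma appr_derive eps delta (P Q : R -> V) (t : R) :
  rotating_solution eps delta P Q ->
  is_derive t (1 : R) (fun s => appr eps delta (P s) (Q s))
    (appr_vel eps delta (P t) (Q t) + eps ^+ 3 *: res_pos eps delta (P t) (Q t)).
Proof.
move=> PQ; have [Pd Qd] := PQ t.
have := is_derive_fD (is_derive_fZ 2 Pd) (is_derive_fZ (eps ^+ 2 * delta / 4)
  (is_derive_emul (is_derive_fB (is_derive_emul Pd Pd)
    (is_derive_fZ 3 (is_derive_emul Qd Qd))) Pd)).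
move=> D; apply: is_derive_eq D _.
apply: ell2_eq => j.
rewrite /appr_vel /res_pos /im3 /cub /slow_re /slow_im /cub /hop; ell2_eval.
by field.
Qed.

(** The terms in rho = eps^2 delta cancel by 8 P^3 = 2 Re z^3 + 6 |z|^2 P. Those in eps^2 cancel
    because the second-neighbour term of [hop] compensates the square of the leading [nbr]. *)
Lemma appr_vel_derive eps delta (P Q : R -> V) (t : R) :
  rotating_solution eps delta P Q ->
  is_derive t (1 : R) (fun s => appr_vel eps delta (P s) (Q s))
    (kg_force eps delta (appr eps delta (P t) (Q t))
     + eps ^+ 3 *: res_vel eps delta (P t) (Q t)).
Proof.
move=> PQ; have [Pd Qd] := PQ t.
have PPd := is_derive_emul Pd Pd; have QQd := is_derive_emul Qd Qd.
have := is_derive_fB (is_derive_fB (is_derive_fD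
  (is_derive_fZ (-1) (is_derive_fZ 2 Qd)) (is_derive_fZ eps (is_derive_hop eps Qd)))
  (is_derive_fZ (3 * (eps ^+ 2 * delta)) (is_derive_emul (is_derive_fD QQd PPd) Qd)))
  (is_derive_fZ (3 * (eps ^+ 2 * delta) / 4)
    (is_derive_emul (is_derive_fB (is_derive_fZ 3 PPd) QQd) Qd)).
under eq_fun do rewrite scaleN1r.
move=> D; apply: is_derive_eq D _.
rewrite /kg_force /res_vel /slow_re /slow_im /hop /appr; nbr_expand.
apply: ell2_eq => j; rewrite /cub /re3; ell2_eval.

by field.
Qed.

End approximation.

(** * Energy of the error *)

Section bounds.
Context {R : realType}.
Local Notation V := (ell2 R).
Implicit Types (x y P Q : V) (a b c d k eps delta : R).

Lemma le_normD x y a b : `|x| <= a -> `|y| <= b -> `|x + y| <= a + b.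
Proof. by move=> xa yb; rewrite (le_trans (ler_normD _ _))// lerD. Qed.

Lemma le_normN x a : `|x| <= a -> `|- x| <= a.
Proof. by rewrite normrN. Qed.

Lemma le_normZ c k x a : `|c| <= k -> `|x| <= a -> `|c *: x| <= k * a.
Proof. by move=> ck xa; rewrite normrZ ler_pM. Qed.

Lemma le_norm_emul x y a b : `|x| <= a -> `|y| <= b -> `|emul x y| <= a * b.
Proof. by move=> xa yb; rewrite (le_trans (normr_emul _ _))// ler_pM. Qed.

Lemma le_norm_nbr x a : `|x| <= a -> `|nbr x| <= 2 * a.
Proof. by move=> xa; rewrite (le_trans (normr_nbr _))// ler_wpM2l. Qed.

Lemma le_normM c d a b : `|c| <= a -> `|d| <= b -> `|c * d| <= a * b.
Proof. by move=> ca db; rewrite normrM ler_pM. Qed.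

Lemma le_normX2 c a : `|c| <= a -> `|c ^+ 2| <= a * a.
Proof. by move=> ca; rewrite expr2 le_normM. Qed.

(** All three expressions are polynomial in eps, delta, P, Q and their shifts, hence bounded on
    bounded sets. *)
Lemma approx_bounds K : exists2 C, 1 <= C &
  forall eps delta P Q, `|eps| <= 1 -> `|delta| <= 1 -> `|P| <= K -> `|Q| <= K ->
  [/\ `|appr eps delta P Q| <= C, `|res_pos eps delta P Q| <= C
    & `|res_vel eps delta P Q| <= C].
Proof.
suff [C1 [C2 [C3 CP]]] : exists C1 C2 C3, forall eps delta P Q,
    `|eps| <= 1 -> `|delta| <= 1 -> `|P| <= K -> `|Q| <= K ->
    [/\ `|appr eps delta P Q| <= C1, `|res_pos eps delta P Q| <= C2
      & `|res_vel eps delta P Q| <= C3].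
  exists (1 + (`|C1| + `|C2| + `|C3|)); first by rewrite lerDl !addr_ge0.
  move=> eps delta P Q he hd hP hQ; have [h1 h2 h3] := CP _ _ _ _ he hd hP hQ.
  have := (normr_ge0 C1, normr_ge0 C2, normr_ge0 C3).
  have := (ler_norm C1, ler_norm C2, ler_norm C3).
  by move=> [[? ?] ?] [[? ?] ?]; split; lra.
(* The constants stay existential variables and are built by following the syntax of each
   expression; [lexx] fixes the bounds of numerical coefficients. *)
eexists; eexists; eexists; move=> eps delta P Q he hd hP hQ.
rewrite /res_pos /res_vel /slow_re /slow_im /appr /re3 /hop /cub.
split; repeat match goal with
  | H : is_true (`|?x| <= _) |- is_true (`|?x| <= _) => exact: H
  | |- is_true (`|emul _ _| <= _) => apply: le_norm_emul
  | |- is_true (`|nbr _| <= _) => apply: le_norm_nbr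
  | |- is_true (`|_ + _| <= _) => apply: le_normD
  | |- is_true (`|_ *: _| <= _) => apply: le_normZ
  | |- is_true (`|_ * _| <= _) => apply: le_normM
  | |- is_true (`|_ ^+ 2| <= _) => apply: le_normX2
  | |- is_true (`|- (_ : V)| <= _) => apply: le_normN
  | |- _ => exact: lexx
  end.
Qed.

End bounds.

Ltac ip_expand := repeat match goal with
  | |- context [ip (?a + ?b) ?c] => rewrite (ipDl a b c)
  | |- context [ip (- ?a) ?c] => rewrite (ipNl a c)
  | |- context [ip ?c (?a + ?b)] => rewrite (ipDr c a b)
  | |- context [ip ?c (- ?a)] => rewrite (ipNr c a)
  | |- context [ip ?c (?k *: ?a)] => rewrite (ipZr k c a)
  end.

(** * Coercivity and growth rate of the energy *)

Section energy.
Context {R : realType}.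
Local Notation V := (ell2 R).
Implicit Types (x y z X : V) (eps rho B D : R).

Definition energy eps y z : R := 2^-1 * (ip z z + ip y y - eps * ip y (nbr y)).

(** The expansion of (X + y)^3 - X^3. *)
Definition cubic_diff X y : V :=
  3 *: emul (emul X X) y + 3 *: emul (emul X y) y + emul (emul y y) y.

Lemma normr_ip_nbr y : `|ip y (nbr y)| <= 2 * `|y| ^+ 2.
Proof.
rewrite (le_trans (normr_ip _ _))// expr2 mulrCA ler_wpM2l//.
exact: normr_nbr.
Qed.

Lemma energy_coercive eps y z : 0 <= eps <= 4^-1 ->
  `|z| ^+ 2 + `|y| ^+ 2 <= 4 * energy eps y z.
Proof.
move=> /andP[e0 e1]; rewrite /energy -!sqr_normE.
have := normr_ip_nbr y; rewrite ler_norml => /andP[_].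
have := sqr_ge0 `|y|; have := sqr_ge0 `|z|.
move: (`|y| ^+ 2) (`|z| ^+ 2) (ip _ _) => Y Z n ? ? ?; nra.
Qed.

Lemma energy_le eps y z : 0 <= eps <= 4^-1 ->
  energy eps y z <= `|z| ^+ 2 + `|y| ^+ 2.
Proof.
move=> /andP[e0 e1]; rewrite /energy -!sqr_normE.
have := normr_ip_nbr y; rewrite ler_norml => /andP[+ _].
have := sqr_ge0 `|y|; have := sqr_ge0 `|z|.
move: (`|y| ^+ 2) (`|z| ^+ 2) (ip _ _) => Y Z n ? ? ?; nra.
Qed.

(** The energy is conserved by the linear flow y' = z, z' = -y + eps nbr y, because [nbr] is
    self-adjoint; only the nonlinearity and the residuals contribute. *)
Lemma energy_derive eps rho (y z : R -> V) (N r1 r2 : V) (t : R) :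
  is_derive t (1 : R) y (z t - r1) ->
  is_derive t (1 : R) z (- y t + eps *: nbr (y t) - rho *: N - r2) ->
  is_derive t (1 : R) (fun s => energy eps (y s) (z s))
    (- rho * ip (z t) N - ip (z t) r2 - ip r1 (y t) + eps * ip r1 (nbr (y t))).
Proof.
have [dy dyE] : exists dy, dy = z t - r1 by eexists.
have [dz dzE] : exists dz, dz = - y t + eps *: nbr (y t) - rho *: N - r2 by eexists.
rewrite -dyE -dzE => yd zd.
have nd := is_derive_fZ eps (is_derive_ip yd (is_derive_nbr yd)).
have := is_derive_fZ 2^-1 (is_derive_fB (is_derive_fD (is_derive_ip zd zd)
  (is_derive_ip yd yd)) nd).
move=> D; apply: is_derive_eq D _; rewrite [in LHS]/GRing.scale/=.
rewrite (ipC (z t) dz) (ipC (y t) dy) (ipC (y t) (nbr dy)) ip_nbr.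
have -> : ip dz (z t) = - ip (z t) (y t) + eps * ip (z t) (nbr (y t))
    - rho * ip (z t) N - ip (z t) r2.
  by rewrite ipC dzE; ip_expand.
by rewrite dyE; ip_expand; field.
Qed.

Lemma normr_cubic_diff X y B : 1 <= B -> `|X| <= B ->
  `|cubic_diff X y| <= 6 * B ^+ 2 * (`|y| + `|y| ^+ 3).
Proof.
move=> B1 XB.
have h1 : `|3 *: emul (emul X X) y| <= 3 * (B * B * `|y|).
  by apply: le_normZ => //; rewrite ?ger0_norm//; do 2 apply: le_norm_emul => //.
have h2 : `|3 *: emul (emul X y) y| <= 3 * (B * `|y| * `|y|).
  by apply: le_normZ => //; rewrite ?ger0_norm//; do 2 apply: le_norm_emul => //.
have h3 : `|emul (emul y y) y| <= `|y| * `|y| * `|y|.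
  by do 2 apply: le_norm_emul => //.
apply: le_trans (le_normD (le_normD h1 h2) h3) _.
have := normr_ge0 y; move: `|y| => a a0.
have h4 : B * a * a <= B ^+ 2 * (a + a ^+ 3).
  (* From a (a - 1)^2 >= 0: the quadratic term is absorbed by the linear and cubic ones. *)
  have h5 : a * a <= a + a ^+ 3.
    by have := mulr_ge0 a0 (sqr_ge0 (a - 1)); have := mulr_ge0 a0 a0; nra.
  by rewrite -mulrA ler_pM// ?mulr_ge0//; nra.
have a3 : 0 <= a ^+ 3 by exact: exprn_ge0.
have B2 : 1 <= B ^+ 2 by exact: exprn_ege1.
have : a ^+ 3 <= B ^+ 2 * a ^+ 3 by rewrite ler_peMl.
have : 0 <= B ^+ 2 * a by rewrite mulr_ge0// ltW// (lt_le_trans ltr01).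
move: h4; rewrite -!expr2 (_ : a * a * a = a ^+ 3); last by ring.
lra.
Qed.

(** Cauchy-Schwarz on each term. The cubic difference gives 48 = 6 * 8; the residual terms, linear
    in D, are split by Young's inequality with weight rho into 4 rho E and a multiple of D^2 /
    rho. *)
Lemma energy_rate eps rho X y z (r1 r2 : V) B D : 0 <= eps <= 4^-1 -> 0 < rho ->
  1 <= B -> `|X| <= B -> 0 <= D -> `|r1| <= D -> `|r2| <= D ->
  `|- rho * ip z (cubic_diff X y) - ip z r2 - ip r1 y + eps * ip r1 (nbr y)|
  <= rho * (48 * B ^+ 2 + 4) * (energy eps y z + energy eps y z ^+ 2)
     + 2 * D ^+ 2 / rho.
Proof.
move=> e01 rho0 B1 XB D0 r1D r2D.
have /andP[e0 e1] := e01.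
have EN := energy_coercive y z e01.
have cz := normr_ip z (cubic_diff X y).
have cN := normr_cubic_diff y B1 XB.
have h2 := normr_ip z r2.
have h1 := normr_ip r1 y.
have hn : `|eps * ip r1 (nbr y)| <= D * `|y|.
  rewrite normrM (ger0_norm e0).
  have hh := normr_ip r1 (nbr y); have hy := normr_nbr y.
  have hD : `|ip r1 (nbr y)| <= 2 * (D * `|y|).
    by rewrite mulrCA (le_trans hh)// ler_pM.
  apply: le_trans (ler_pM _ _ e1 hD) _ => //.
  have := mulr_ge0 D0 (normr_ge0 y); lra.
set E := energy eps y z in EN *.
have tri : `|- rho * ip z (cubic_diff X y) - ip z r2 - ip r1 y + eps * ip r1 (nbr y)|
    <= rho * (`|z| * (6 * B ^+ 2 * (`|y| + `|y| ^+ 3))) + `|z| * D + D * `|y| + D * `|y|.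
  apply: le_trans (ler_normD _ _) _; apply: lerD => //.
  apply: le_trans (ler_normD _ _) _; rewrite normrN; apply: lerD; last first.
    by rewrite (le_trans h1)// ler_wpM2r.
  apply: le_trans (ler_normD _ _) _; rewrite normrN; apply: lerD; last first.
    by rewrite (le_trans h2)// ler_wpM2l.
  rewrite normrM normrN (gtr0_norm rho0) ler_wpM2l ?(ltW rho0)//.
  by rewrite (le_trans cz)// ler_wpM2l.
apply: le_trans tri _.
move: EN (normr_ge0 z) (normr_ge0 y); move: `|z| `|y| => a b EN a0 b0.
have S0 : 0 <= E by have := sqr_ge0 a; have := sqr_ge0 b; lra.
(* Coercivity gives a b <= 2 E and b^2 <= 4 E, hence a b^3 <= 8 E^2. *)
have k1 : a * (b + b ^+ 3) <= 8 * (E + E ^+ 2).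
  have ab : a * b <= 2 * E by have := sqr_ge0 (a - b); nra.
  have bb : b ^+ 2 <= 4 * E by have := sqr_ge0 a; lra.
  have : a * b * b ^+ 2 <= 2 * E * (4 * E) by rewrite ler_pM// ?mulr_ge0// sqr_ge0.
  have -> : a * (b + b ^+ 3) = a * b + a * b * b ^+ 2 by ring.
  by nra.
have k2 : a * D + D * b + D * b <= 4 * rho * E + 2 * D ^+ 2 / rho.
  have j (x : R) : x * D <= rho * x ^+ 2 / 2 + D ^+ 2 / rho / 2.
    have -> : rho * x ^+ 2 / 2 + D ^+ 2 / rho / 2 = x * D + (rho * x - D) ^+ 2 / rho / 2.
      by field; rewrite gt_eqF.
    by rewrite lerDl divr_ge0// divr_ge0 ?sqr_ge0// ltW.
  have := j a; have := j b; have : rho * (a ^+ 2 + b ^+ 2) <= rho * (4 * E).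
    by rewrite ler_wpM2l// ltW.
  have : 0 <= D ^+ 2 / rho by rewrite divr_ge0 ?sqr_ge0// ltW.
  have : 0 <= rho * a ^+ 2 by rewrite mulr_ge0 ?sqr_ge0// ltW.
  rewrite -(mulrA 2 (D ^+ 2)); move: (D ^+ 2 / rho) => w.
  lra.
have k3 : rho * (a * (6 * B ^+ 2 * (b + b ^+ 3))) <= rho * (6 * B ^+ 2) * (8 * (E + E ^+ 2)).
  have -> : rho * (a * (6 * B ^+ 2 * (b + b ^+ 3))) =
    rho * (6 * B ^+ 2) * (a * (b + b ^+ 3)) by ring.
  by rewrite ler_wpM2l// mulr_ge0 ?(ltW rho0)// mulr_ge0 ?sqr_ge0.
have : 0 <= rho * E ^+ 2 by rewrite mulr_ge0 ?sqr_ge0// ltW.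
move: k2 k3; lra.
Qed.

End energy.

(** * Stability of the approximation under the Klein-Gordon flow *)

Section stability.
Context {R : realType}.
Local Notation V := (ell2 R).

(** Here [theta] is the size of the initial error and [w] bounds its amplified size, the energy
    growing at twice the exponential rate of the norm. The bound on [w] is the smallness required by
    [log_gronwall]; the final [C * eps ^+ 3] is the gap between the velocity V and the true
    derivative of X. *)
Lemma stability (K C eps delta theta w : R) (P Q x v : R -> V) (t : R) :
  let rho := eps ^+ 2 * delta in
  1 <= C ->
  (forall eps delta (P Q : V),
    `|eps| <= 1 -> `|delta| <= 1 -> `|P| <= K -> `|Q| <= K ->
    [/\ `|appr eps delta P Q| <= C, `|res_pos eps delta P Q| <= C
      & `|res_vel eps delta P Q| <= C]) ->
  0 < eps <= 4^-1 -> 0 < delta <= 1 -> theta = eps ^+ 3 / rho ->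
  rotating_solution eps delta P Q ->
  (forall s, `|P s| <= K) -> (forall s, `|Q s| <= K) ->
  (forall s, is_derive s (1 : R) x (v s)) ->
  (forall s, is_derive s (1 : R) v (kg_force eps delta (x s))) ->
  let X s := appr eps delta (P s) (Q s) in
  let dX s := appr_vel eps delta (P s) (Q s)
              + eps ^+ 3 *: res_pos eps delta (P s) (Q s) in
  `|x 0 - X 0| + `|v 0 - dX 0| <= theta ->
  expR (rho * (48 * C ^+ 2 + 4) * `|t|) * theta ^+ 2 <= w ^+ 2 ->
  0 <= w -> w <= (2 * (1 + C))^-1 ->
  `|x t - X t| + `|v t - dX t| <= 8 * (1 + C) * w + C * eps ^+ 3.
Proof.
move=> rho C1 bnd /andP[e0 e4] /andP[d0 d1] thetaE PQ PK QK xd vd X dX init small w0 w1.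
have e01 : 0 <= eps <= 4^-1 by rewrite ltW.
have e1 : eps <= 1 by lra.
have rho0 : 0 < rho by rewrite mulr_gt0// exprn_gt0.
have rho1 : rho <= 1.
  by apply: mulr_ile1 => //; rewrite ?exprn_ge0 ?exprn_ile1// ltW.
have e30 : 0 < eps ^+ 3 by rewrite exprn_gt0.
have ne : `|eps| <= 1 by rewrite gtr0_norm.
have nd : `|delta| <= 1 by rewrite gtr0_norm.
have B s := bnd eps delta (P s) (Q s) ne nd (PK s) (QK s).
pose y s := x s - X s; pose z s := v s - appr_vel eps delta (P s) (Q s).
pose r1 s := eps ^+ 3 *: res_pos eps delta (P s) (Q s).
pose r2 s := eps ^+ 3 *: res_vel eps delta (P s) (Q s).
pose D := C * eps ^+ 3.
have r1D s : `|r1 s| <= D.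
  by have [_ h _] := B s; rewrite normrZ gtr0_norm// mulrC ler_wpM2r// ltW.
have r2D s : `|r2 s| <= D.
  by have [_ _ h] := B s; rewrite normrZ gtr0_norm// mulrC ler_wpM2r// ltW.
have XC s : `|X s| <= C by have [] := B s.
have C0 : 0 <= C by lra.
have D0 : 0 <= D by rewrite mulr_ge0// ltW.
have yd s : is_derive s (1 : R) y (z s - r1 s).
  apply: is_derive_eq (is_derive_fB (xd s) (appr_derive s PQ)) _.
  by rewrite /z /r1 opprD addrA.
have zd s : is_derive s (1 : R) z
    (- y s + eps *: nbr (y s) - rho *: cubic_diff (X s) (y s) - r2 s).
  apply: is_derive_eq (is_derive_fB (vd s) (appr_vel_derive s PQ)) _.
  rewrite /r2 opprD addrA; congr (_ - _); rewrite /y -/(X s) /kg_force /cubic_diff -/rho.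
  move: (X s) => Xs; nbr_expand; apply: ell2_eq => j; ell2_eval.
  by ring.
pose E s := energy eps (y s) (z s).
have Ed s := energy_derive (yd s) (zd s).
have E0 s : 0 <= E s.
  have := energy_coercive (y s) (z s) e01; rewrite -/(E s).
  by have := sqr_ge0 `|y s|; have := sqr_ge0 `|z s|; lra.
set c := rho * (48 * C ^+ 2 + 4) in small.
pose b := 2 * D ^+ 2 / rho.
have c0 : 0 < c by rewrite mulr_gt0// ltr_wpDl// mulr_ge0// sqr_ge0.
have b0 : 0 <= b by rewrite divr_ge0 ?mulr_ge0 ?sqr_ge0// ltW.
have rate s := energy_rate (y s) (z s) e01 rho0 C1 (XC s) D0 (r1D s) (r2D s).
have theta0 : 0 <= theta by rewrite thetaE divr_ge0// ltW.
have e3theta : eps ^+ 3 <= theta by rewrite thetaE ler_peMr ?invf_ge1// ltW.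
have vz s : v s - dX s = z s - r1 s by rewrite /dX /z /r1 opprD addrA.
(* The factor 1 + C accounts for replacing [dX 0] by V at time 0, which costs at most C eps^3 <= C
   theta. *)
have E0theta : E 0 <= (1 + C) ^+ 2 * theta ^+ 2.
  apply: le_trans (energy_le _ _ e01) _; rewrite -exprMn.
  have : `|y 0| + `|z 0| <= (1 + C) * theta.
    have : `|z 0| <= `|v 0 - dX 0| + D.
      rewrite vz -[X in `|X| <= _](subrK (r1 0)).
      by rewrite (le_trans (ler_normD _ _))// lerD2l.
    have : D <= C * theta by rewrite ler_wpM2l.
    by move: init; rewrite -/(y 0); lra.
  have := normr_ge0 (y 0); have := normr_ge0 (z 0).
  move: `|y 0| `|z 0| (_ * theta) => a a' m ? ? am.
  have : (a + a') ^+ 2 <= m ^+ 2 by rewrite ler_pXn2r ?nnegrE//; lra.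
  by nra.
(* In b / c the powers of rho combine into theta^2: the accumulated residual has the same order as
   the initial error. *)
have bc : b / c <= (1 + C) ^+ 2 * theta ^+ 2.
  have -> : b / c = 2 / (48 * C ^+ 2 + 4) * (C ^+ 2 * theta ^+ 2).
    rewrite /b /c /D thetaE; field; rewrite !gt_eqF//.
    by rewrite ltr_wpDl// mulr_ge0// sqr_ge0.
  have h : 2 / (48 * C ^+ 2 + 4) <= 1.
    by rewrite ler_pdivrMr ?mul1r; have := sqr_ge0 C; lra.
  apply: le_trans (ler_piMl _ h) _; first by rewrite mulr_ge0 ?sqr_ge0.
  rewrite ler_wpM2r ?sqr_ge0//.
  by nra.
set G := expR _ in small; have G0 : 0 < G by exact: expR_gt0.
have Gb : G * (E 0 + b / c) <= 2 * ((1 + C) * w) ^+ 2.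
  apply: (@le_trans _ _ (2 * (1 + C) ^+ 2 * (G * theta ^+ 2))).
    rewrite mulrCA ler_pM2l//; lra.
  by rewrite exprMn -mulrA !ler_wpM2l// sqr_ge0.
have Cw : (1 + C) * w <= 2^-1.
  by move: w1; rewrite invfM ler_pdivlMr//; lra.
have Cw0 : 0 <= (1 + C) * w by rewrite mulr_ge0//; lra.
have Gs : G * (E 0 + b / c) <= 2^-1.
  by apply: le_trans Gb _; move: ((1 + C) * w) Cw Cw0 => m; nra.
have Et := log_gronwall Ed E0 rate c0 b0 Gs.
have S := energy_coercive (y t) (z t) e01.
rewrite -/(E t) in S.
have hS : `|z t| ^+ 2 + `|y t| ^+ 2 <= (4 * ((1 + C) * w)) ^+ 2.
  have -> : (4 * ((1 + C) * w)) ^+ 2 = 16 * ((1 + C) * w) ^+ 2 by ring.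
  have Et2 : E t <= 2 * (G * (E 0 + b / c)) by exact: Et.
  by lra.
have m0 : 0 <= 4 * ((1 + C) * w) by exact: mulr_ge0.
have hy : `|y t| <= 4 * ((1 + C) * w).
  by rewrite -(@ler_pXn2r _ 2)// ?nnegrE//; have := sqr_ge0 `|z t|; lra.
have hz : `|z t| <= 4 * ((1 + C) * w).
  by rewrite -(@ler_pXn2r _ 2)// ?nnegrE//; have := sqr_ge0 `|y t|; lra.
rewrite vz -/(y t).
have := le_normD (lexx `|z t|) (le_normN (r1D t)).
by rewrite /D; lra.
Qed.

End stability.

(** * From sequences of numbers to l^2-valued solutions *)

Section bridges.
Context {R : realType}.
Local Notation V := (ell2 R).
Local Notation Re := complex.Re.
Local Notation Im := complex.Im.

Lemma l2norm_ge0 (f : int -> R) : (0 <= l2norm f)%E.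
Proof. exact: poweR_ge0. Qed.

Lemma l2norm_le (f g : int -> R) : (forall j, `|f j| <= `|g j|) ->
  (l2norm f <= l2norm g)%E.
Proof.
move=> fg; rewrite /l2norm; apply: gt0_ler_poweR => //.
- by rewrite in_itv/= leey andbT; apply: esum_ge0 => j _; rewrite lee_fin sqr_ge0.
- by rewrite in_itv/= leey andbT; apply: esum_ge0 => j _; rewrite lee_fin sqr_ge0.
apply: le_esum => j _; rewrite lee_fin.
by rewrite -(real_normK (num_real (f j))) -(real_normK (num_real (g j))) lerXn2r ?nnegrE.
Qed.

Lemma normr_Re_le (z : R[i]) : `|Re z| <= ComplexField.Normc.normc z.
Proof.
case: z => x y /=; rewrite -sqrtr_sqr ler_sqrt ?addr_ge0 ?sqr_ge0//.
by rewrite lerDl sqr_ge0.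
Qed.

Lemma normr_Im_le (z : R[i]) : `|Im z| <= ComplexField.Normc.normc z.
Proof.
case: z => x y /=; rewrite -sqrtr_sqr ler_sqrt ?addr_ge0 ?sqr_ge0//.
by rewrite lerDr sqr_ge0.
Qed.

Lemma l2norm_component (f : R[i] -> R) (z : int -> R[i]) :
  (forall w, `|f w| <= ComplexField.Normc.normc w) ->
  (l2norm (fun j => f (z j)) <= cl2norm z)%E.
Proof. by move=> fn; apply: l2norm_le => j; rewrite (le_trans (fn _))// ler_norm. Qed.

Lemma in_l2_component (f : R[i] -> R) (z : int -> R[i]) :
  (forall w, `|f w| <= ComplexField.Normc.normc w) ->
  in_cl2 z -> in_l2 (fun j => f (z j)).
Proof. by move=> fn; apply: le_lt_trans; exact: l2norm_component. Qed.

(** Here [f] is Re or Im: real-linear and bounded by the modulus, so its difference quotients are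
    dominated by the complex ones. *)
Lemma is_l2_derive_component (f : R[i] -> R) (z : R -> int -> R[i]) t dz :
  (forall w, `|f w| <= ComplexField.Normc.normc w) ->
  (forall w w', f (w - w') = f w - f w') ->
  (forall x w, f (x%:C%C * w) = x * f w) ->
  is_cl2_derive z t dz ->
  is_l2_derive (fun s j => f (z s j)) t (fun j => f (dz j)).
Proof.
move=> fn fB fZ zd.
apply: (@squeeze_cvge _ _ _ _ (cst 0%E) _ _ _ _ (cvg_cst _) zd).
apply: nearW => h; rewrite l2norm_ge0/=.
rewrite (_ : (fun j => _) = (fun j => f ((h^-1)%:C%C * (z (t + h) j - z t j) - dz j))).
  exact: l2norm_component.
by apply/funext => j; rewrite fB fZ fB.
Qed.

Lemma nbr_nbr (u : V) j : nbr (nbr u) j = u (j + 2) + 2 * u j + u (j - 2).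
Proof.
rewrite !nbrE addrK subrK -!addrA -opprD.
by rewrite mulr_natl mulr2n !addrA.
Qed.

Lemma dNLS_real_imag (eps delta u v x y : R) (b d : R[i]) :
  2 * 'i%C * (u +i* v)%C + 3 * eps%:C%C * delta%:C%C * `|(x +i* y)%C| ^+ 2 * (x +i* y)%C
    = b + eps%:C%C / 4 * d ->
  u = 2^-1 * (Im b + eps / 4 * Im d - 3 * eps * delta * ((y ^+ 2 + x ^+ 2) * y)) /\
  v = - 2^-1 * (Re b + eps / 4 * Re d - 3 * eps * delta * ((x ^+ 2 + y ^+ 2) * x)).
Proof.
have e n : (n%:R : R[i]) = (n%:R : R)%:C%C by rewrite rmorph_nat.
rewrite -add_Re2_Im2 (e 2) (e 3) (e 4) -fmorphV -!rmorphM/=.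
case: b d => b1 b2 [d1 d2] /eqP; rewrite eq_complex /= => /andP[/eqP h1 /eqP h2].
by split; lra.
Qed.

Lemma dNLS_components (eps delta : R) (a : R -> int -> R[i]) :
  dNLS_solution eps delta a -> exists p q : R -> V,
  [/\ forall tau j, p tau j = Re (a tau j), forall tau j, q tau j = Im (a tau j)
    & dNLS_real_solution eps (3 * eps * delta) p q].
Proof.
move=> [al2 [da [ad eqa]]].
pose p tau : V := mk_ell2 (in_l2_component normr_Re_le (al2 tau)).
pose q tau : V := mk_ell2 (in_l2_component normr_Im_le (al2 tau)).
exists p, q; split=> // tau.
have eqn j := @dNLS_real_imag eps delta (Re (da tau j)) (Im (da tau j))
  (Re (a tau j)) (Im (a tau j)) (a tau (j + 1) + a tau (j - 1))
  (a tau (j + 2) + 2 * a tau j + a tau (j - 2)).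
have ReD (w w' : R[i]) : Re (w + w') = Re w + Re w' by case: w w' => ? ? [].
have ImD (w w' : R[i]) : Im (w + w') = Im w + Im w' by case: w w' => ? ? [].
have ReB (w w' : R[i]) : Re (w - w') = Re w - Re w' by case: w w' => ? ? [].
have ImB (w w' : R[i]) : Im (w - w') = Im w - Im w' by case: w w' => ? ? [].
have ReZ (k : R) (w : R[i]) : Re (k%:C%C * w) = k * Re w.
  by case: w => ? ? /=; rewrite mul0r subr0.
have ImZ (k : R) (w : R[i]) : Im (k%:C%C * w) = k * Im w.
  by case: w => ? ? /=; rewrite mul0r addr0.
have e2 : (2 : R[i]) = (2 : R)%:C%C by rewrite rmorph_nat.
have ec (w : R[i]) : (Re w +i* Im w)%C = w by case: w.
split; apply: is_derive_of_l2.
  have zd := is_l2_derive_component normr_Re_le ReB ReZ (ad tau).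
  rewrite [X in is_l2_derive _ _ X](_ : _ = fun j => Re (da tau j)); first exact: zd.
  apply/funext => j; move: (eqn j); rewrite !ec => /(_ (eqa tau j))[+ _] => ->.
  rewrite /hop /cub; ell2_eval; rewrite nbr_nbr nbrE !ImD e2 ImZ.
  by ring.
have zd := is_l2_derive_component normr_Im_le ImB ImZ (ad tau).
rewrite [X in is_l2_derive _ _ X](_ : _ = fun j => Im (da tau j)); first exact: zd.
apply/funext => j; move: (eqn j); rewrite !ec => /(_ (eqa tau j))[_ ->].
rewrite /hop /cub; ell2_eval; rewrite nbr_nbr nbrE !ReD e2 ReZ.
by ring.
Qed.

Lemma leading_orderE eps delta (a : R -> int -> R[i]) (p q : R -> V) t :
  (forall tau j, p tau j = Re (a tau j)) ->
  (forall tau j, q tau j = Im (a tau j)) ->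
  leading_order eps (eps ^+ 2 * delta) a t =
  appr eps delta (cos t *: p (eps * t) - sin t *: q (eps * t))
                 (sin t *: p (eps * t) + cos t *: q (eps * t)).
Proof.
move=> pE qE; apply/funext => j.
have e8 : (8^-1 : R[i]) = (8^-1)%:C%C by rewrite fmorphV rmorph_nat.
rewrite /leading_order /appr /re3 e8; ell2_eval; rewrite pE qE.
(* The addition formulas turn e^{3it} into (cos t + i sin t)^3, which makes the claim a polynomial
   identity. *)
rewrite (_ : 3 * t = t + (t + t)); last by ring.
rewrite /expi !(cosN, sinN, cosD, sinD).
case: (a (eps * t) j) => x y /=.
set c := cos t; set s := sin t.
by field.
Qed.
End bridges.

(** * The Klein-Gordon equation in l^2 and the size of the error *)

Section error_bound.
Context {R : realType}.
Local Notation V := (ell2 R).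

Lemma dKG_ell2 eps delta (xi : R -> int -> R) :
  dKG_solution eps (eps ^+ 2 * delta) xi ->
  exists x v : R -> V,
  [/\ forall s, xi s = x s, forall s, dot xi s = v s,
      forall s, is_derive s (1 : R) x (v s)
    & forall s, is_derive s (1 : R) v (kg_force eps delta (x s))].
Proof.
move=> [H eqn].
have xl s : in_l2 (xi s) by have [] := H s.
have vl s : in_l2 (dot xi s) by have [] := H s.
exists (fun s => mk_ell2 (xl s)), (fun s => mk_ell2 (vl s)).
split; [by []|by []|move=> s..]; apply: is_derive_of_l2; first by have [] := H s.
suff <- : dot (dot xi) s = kg_force eps delta (mk_ell2 (xl s)) by have [] := H s.
apply/funext => j; have := eqn s j.
rewrite /kg_force; ell2_eval; rewrite nbrE /= => h.
by move: h; rewrite (_ : xi s j ^+ 3 = xi s j * xi s j * xi s j); [lra|ring].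
Qed.

(* [expR (alpha * `|ln rho|)] is the growth [rho `^ (- alpha)] of the error
   over the time span. *)
Lemma error_scale (alpha eps rho eta : R) : 0 < alpha -> 0 < eps ->
  0 < rho -> rho <= 1 -> eta <= 1 -> eps `^ (3 / (1 + alpha)) / rho <= eta ->
  let w := eps ^+ 3 / rho * expR (alpha * `|ln rho|) in
  [/\ w = rho `^ (- 1 - alpha) * eps ^+ 3, w <= eta & eps ^+ 3 <= w].
Proof.
move=> al0 e0 r0 r1 eta1 h w.
have L0 : ln rho <= 0 by rewrite ln_le0.
have rE : rho = expR (ln rho) by rewrite lnK.
have e3E : eps ^+ 3 = expR (3 * ln eps) by rewrite expRM_natl lnK.
split.
- rewrite /w ler0_norm// /powR gt_eqF// mulrBl mulN1r expRD expRN -rE -mulNr.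
  by rewrite mulrN -mulNr; ring.
- have h1 := le_trans h eta1; apply: le_trans h.
  have xE : eps `^ (3 / (1 + alpha)) / rho = expR (3 / (1 + alpha) * ln eps - ln rho).
    by rewrite /powR gt_eqF// expRD expRN -rE.
  (* [w] is the (1 + alpha)-th power of eps^(3 / (1 + alpha)) / rho; this base is at most 1, so the
     power does not exceed it. *)
  have wE : w = expR ((1 + alpha) * (3 / (1 + alpha) * ln eps - ln rho)).
    rewrite /w e3E [in X in X * _]rE -expRN -!expRD ler0_norm//; congr expR.
    by field; rewrite gt_eqF//; lra.
  have : 3 / (1 + alpha) * ln eps - ln rho <= 0 by rewrite -ler_expR expR0 -xE.
  rewrite xE wE ler_expR.
  by move: (_ - ln rho) => m m0; nra.
- rewrite /w -mulrA ler_peMr ?exprn_ge0 ?(ltW e0)//.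
  rewrite -[1]mulr1 ler_pM//; first by rewrite invf_ge1.
  by rewrite -[leLHS]expR0 ler_expR mulr_ge0// ltW.
Qed.

End error_bound.

Lemma rot_norm_le (R : realType) (c s K : R) (P Q : ell2 R) :
  `|c| <= 1 -> `|s| <= 1 -> `|P| <= K -> `|Q| <= K ->
  `|c *: P - s *: Q| <= 2 * K /\ `|s *: P + c *: Q| <= 2 * K.
Proof.
move=> c1 s1 PK QK; have -> : 2 * K = 1 * K + 1 * K by ring.
by split; apply: le_normD; rewrite ?normrN; apply: le_normZ.
Qed.

Unset Implicit Arguments.
Set Strict Implicit.
Set Printing Implicit Defensive.

Theorem theorem4 (R : realType) (alpha : R) (rho : R -> R)
    (a0 : int -> R[i])
    (halpha : 0 < alpha < 2^-1)
    (hrho : asymptotic_range alpha rho)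
    (ha0 : in_cl2 a0) :
  exists2 A0 : R, 0 < A0 &
  forall A : R, 0 < A < A0 ->
  exists eps0 C0 C : R, [/\ 0 < eps0, 0 < C0, 0 < C &
  forall (eps : R) (a : R -> int -> R[i]) (xi : R -> int -> R),
    0 < eps < eps0 ->
    dNLS_solution eps (rho eps / eps ^+ 2) a -> a 0 = a0 ->
    dKG_solution eps (rho eps) xi ->
    let X := leading_order eps (rho eps) a in
    (l2norm (xi 0 \- X 0)%R + l2norm (dot xi 0 \- dot X 0)%R
       <= (C0 * (rho eps)^-1 * eps ^+ 3)%:E)%E ->
    forall t : R,
      t \in `[- (A * `|ln (rho eps)| * (rho eps)^-1),
              A * `|ln (rho eps)| * (rho eps)^-1] ->
      (l2norm (xi t \- X t)%R + l2norm (dot xi t \- dot X t)%R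
         <= (C * rho eps `^ (- 1 - alpha) * eps ^+ 3)%:E)%E].
Proof.
have /andP[al0 _] := halpha.
pose p0 : ell2 R := mk_ell2 (in_l2_component (@normr_Re_le R) ha0).
pose q0 : ell2 R := mk_ell2 (in_l2_component (@normr_Im_le R) ha0).
pose K0 := `|p0| + `|q0|.
(* [K0] bounds p and q for all times by mass conservation; rotating by the phase at most doubles
   it. *)
have [C C1 bnd] := approx_bounds (2 * K0).
pose c1 := 48 * C ^+ 2 + 4.
have c10 : 0 < c1 by rewrite ltr_wpDl// mulr_ge0// sqr_ge0.
(* The energy grows at rate rho c1, so A c1 <= 2 alpha keeps its growth over the time span below
   rho^(-2 alpha), that is rho^(-alpha) for the norm. *)
exists (2 * alpha / c1); first by rewrite divr_gt0// mulr_gt0.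
move=> A /andP[A0 A1].
pose eta := (2 * (1 + C))^-1.
have eta0 : 0 < eta by rewrite invr_gt0; lra.
have eta1 : eta <= 1 by rewrite invf_le1; lra.
have [e0 e00 small] : exists2 e0, 0 < e0 & forall eps, 0 < eps < e0 ->
    [/\ 0 < rho eps <= eps ^+ 2, eps <= 4^-1
      & eps `^ (3 / (1 + alpha)) / rho eps <= eta].
  have : \forall eps \near 0^'+, [/\ 0 < rho eps <= eps ^+ 2, eps <= 4^-1
      & eps `^ (3 / (1 + alpha)) / rho eps <= eta].
    have [h1 h2] := hrho; near=> eps; split; near: eps => //.
      by apply: nbhs_right_le; rewrite invr_gt0.
    exact: cvgr_le h2 _ eta0.
  move=> [e /= ep H]; exists e => // eps /andP[p pe]; apply: H => //=.
  by rewrite sub0r normrN gtr0_norm.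
(* Stability yields 8 (1 + C) w + C eps^3, and eps^3 <= w, whence the factor 9 (1 + C). *)
exists e0, 1, (9 * (1 + C)); split=> //; first by lra.
move=> eps a xi heps dnls a0E dkg X init t tI.
have [/andP[r0 re] e4 xeta] := small _ heps.
have /andP[ep _] := heps.
set r := rho eps in r0 re xeta dnls dkg X init tI *.
pose delta := r / eps ^+ 2.
have e20 : 0 < eps ^+ 2 by exact: exprn_gt0.
have rE : r = eps ^+ 2 * delta by rewrite mulrC divfK// gt_eqF.
have d0 : 0 < delta by exact: divr_gt0.
have d1 : delta <= 1 by rewrite ler_pdivrMr// mul1r.
have r1 : r <= 1.
  by rewrite (le_trans re)// exprn_ile1//; lra.
have [p [q [pE qE pq]]] := dNLS_components dnls.
have mass tau : `|p tau| <= K0 /\ `|q tau| <= K0.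
  have := dNLS_mass tau pq.
  have -> : p 0 = p0 by apply: ell2_eq => j; rewrite pE a0E.
  have -> : q 0 = q0 by apply: ell2_eq => j; rewrite qE a0E.
  have p00 := normr_ge0 p0; have q00 := normr_ge0 q0.
  have K00 : 0 <= K0 by exact: addr_ge0.
  have KE : K0 ^+ 2 = `|p0| ^+ 2 + `|q0| ^+ 2 + 2 * (`|p0| * `|q0|) by rewrite /K0; ring.
  have := mulr_ge0 p00 q00; have := sqr_ge0 `|p tau|; have := sqr_ge0 `|q tau|.
  by move=> ? ? ? ?; split; rewrite -(@ler_pXn2r _ 2)// ?nnegrE// KE; lra.
have PQ := dNLS_rotating pq.
set P := (fun t => cos t *: _ - _) in PQ; set Q := (fun t => sin t *: _ + _) in PQ.
have PQK s : `|P s| <= 2 * K0 /\ `|Q s| <= 2 * K0.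
  have [? ?] := mass (eps * s).
  by apply: rot_norm_le => //; rewrite ler_norml ?cos_le1 ?cos_geN1 ?sin_le1 ?sin_geN1.
rewrite rE in dkg.
have [x [v [xE vE xd vd]]] := dKG_ell2 dkg.
pose dX s := appr_vel eps delta (P s) (Q s) + eps ^+ 3 *: res_pos eps delta (P s) (Q s).
have XE s : X s = appr eps delta (P s) (Q s).
  by rewrite /X rE (leading_orderE _ _ _ pE qE).
(* [dot] is a sitewise derivative; it is read off the l^2 derivative through the bounded coordinate
   maps. *)
have dXE s : dot X s = dX s.
  apply/funext => j; rewrite /dot derive1E.
  under eq_fun do rewrite XE.
  by have := is_derive_coord j (appr_derive s PQ) => /(@derive_val _ _ _ _ _ _ _).
have err s : (l2norm (xi s \- X s)%R + l2norm (dot xi s \- dot X s)%R)%E =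
    (`|x s - appr eps delta (P s) (Q s)| + `|v s - dX s|)%:E.
  rewrite EFinD -!l2normE XE dXE xE vE.
  by congr (l2norm _ + l2norm _)%E; apply/funext => j; ell2_eval.
rewrite err lee_fin mul1r mulrC in init; rewrite err lee_fin.
have e40 : 0 < eps <= 4^-1 by rewrite ep.
have d01 : 0 < delta <= 1 by rewrite d0.
have thE : eps ^+ 3 / r = eps ^+ 3 / (eps ^+ 2 * delta) by rewrite -rE.
have [wE weta e3w] := error_scale al0 ep r0 r1 eta1 xeta.
set w := _ * expR _ in wE weta e3w.
have w0 : 0 <= w by rewrite (le_trans _ e3w)// exprn_ge0// ltW.
have tA : `|t| <= A * `|ln r| / r by rewrite ler_norml.
have growth : expR (eps ^+ 2 * delta * c1 * `|t|) * (eps ^+ 3 / r) ^+ 2 <= w ^+ 2.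
  rewrite /w [leRHS]exprMn [leLHS]mulrC ler_wpM2l ?sqr_ge0//.
  rewrite [leRHS]expr2 -expRD ler_expR -rE.
  have h : r * `|t| <= A * `|ln r|.
    by rewrite mulrC -ler_pdivlMr.
  have hA : c1 * A <= 2 * alpha by move: A1; rewrite ltr_pdivlMr// mulrC => /ltW.
  have -> : r * c1 * `|t| = c1 * (r * `|t|) by ring.
  have -> : alpha * `|ln r| + alpha * `|ln r| = 2 * alpha * `|ln r| by ring.
  apply: le_trans (_ : c1 * (A * `|ln r|) <= _); first by rewrite ler_pM2l.
  by rewrite mulrA ler_wpM2r.
have := stability C1 bnd e40 d01 thE PQ (fun s => (PQK s).1) (fun s => (PQK s).2)
  xd vd init growth w0 weta.
move=> /le_trans; apply.
rewrite -[leRHS]mulrA -wE.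
have : C * eps ^+ 3 <= C * w by rewrite ler_wpM2l//; lra.
by move: w0; lra.
Unshelve. all: by end_near.
Qed.
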